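(* Let $n\ge 1$. The translation maximal operator $\mathcal M_{\mathrm{trans}}$ is of weak type $(1,1)$ on $(G_n,\mu)$, that is, there is a constant $C$ such that $\mu\{\mathcal M_{\mathrm{trans}}f>\lambda\}\le \frac{C}{\lambda}\|f\|_{L^1(G_n)}$ for all $f\in L^1(G_n)$ and $\lambda>0$. It is bounded on $L^p(G_n)$ for every $1<p\le\infty$, that is, for each such $p$ there is a constant $C$ such that $\|\mathcal M_{\mathrm{trans}}f\|_{L^p(G_n)}\le C\|f\|_{L^p(G_n)}$ for all $f\in L^p(G_n)$. It is not bounded from $L^1(G_n)$ to $L^1(G_n)$, that is, there is no constant $C$ such that $\|\mathcal M_{\mathrm{trans}}f\|_{L^1(G_n)}\le C\|f\|_{L^1(G_n)}$ for all $f\in L^1(G_n)$.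
   Context: $G_n=\mathbb R^n\rtimes\mathbb R_+$ is the set $\mathbb R^n\times(0,\infty)$ with group law $(x,y)(x',y')=(x+yx',yy')$, equipped with the left Haar measure $d\mu(x,y)=\frac{dx\,dy}{y^{n+1}}$; $L^p(G_n)$ is taken with respect to $\mu$. For $r>0$, $B_r\subset\mathbb R^n$ is the Euclidean ball of radius $r$ centered at the origin and $|B_r|$ is its Lebesgue measure. For $f\in L^1_{\mathrm{loc}}(G_n)$, $$\mathcal M_{\mathrm{trans}}f(x,y)=\sup_{r>0}\frac1{|B_r|}\int_{B_r}|f(x+yt,y)|\,dt .$$ *)

(* Defs.v *)
From HB Require Import structures.
From mathcomp Require Import all_boot all_order all_algebra.
From mathcomp Require Import all_classical all_reals all_analysis.
From mathcomp Require Import measurable_realfun.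

Set Implicit Arguments.
Unset Strict Implicit.
Unset Printing Implicit Defensive.
Import Order.TTheory GRing.Theory Num.Theory.
Import numFieldNormedType.Exports.

Local Open Scope classical_set_scope.
Local Open Scope ring_scope.

(* R^n is 'rV[R]_n, with the sigma-algebra generated by the coordinates (that
   is, the Borel sigma-algebra), as the library does for n.-tuple R. *)
Definition rV_display : measure_display.
Proof. exact: default_measure_display. Qed.

Definition rV_coor {R : realType} {n : nat} (i : 'I_n) (v : 'rV[R]_n) : R :=
  v ord0 i.

Section rV_measurable.
Context {R : realType} (n : nat).

Let coor : 'I_n -> 'rV[R]_n -> R := rV_coor.

Let rV_set0 : g_sigma_preimage coor set0.
Proof. exact: sigma_algebra0. Qed.

Let rV_setC A : g_sigma_preimage coor A -> g_sigma_preimage coor (~` A).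
Proof. exact: sigma_algebraC. Qed.

Let rV_bigcup (F : (set 'rV[R]_n)^nat) :
  (forall i, g_sigma_preimage coor (F i)) ->
  g_sigma_preimage coor (\bigcup_i (F i)).
Proof. exact: sigma_algebra_bigcup. Qed.

HB.instance Definition _ := @isMeasurable.Build rV_display
  'rV[R]_n (g_sigma_preimage coor) rV_set0 rV_setC rV_bigcup.

End rV_measurable.

Lemma measurable_rV_coor (R : realType) n (i : 'I_n) :
  measurable_fun [set: 'rV[R]_n] (rV_coor i).
Proof.
move=> _ Y mY; rewrite setTI; apply: sub_sigma_algebra => /=.
rewrite -bigcup_seq/=; exists i => /=; first by rewrite mem_index_enum.
by exists Y => //; rewrite setTI.
Qed.

Lemma measurable_fun_rVP (R : realType) d (T : measurableType d) n
    (f : T -> 'rV[R]_n) :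
  (forall i, measurable_fun [set: T] (rV_coor i \o f)) ->
  measurable_fun [set: T] f.
Proof.
move=> mf.
have sub : g_sigma_preimage (fun i => rV_coor i \o f) `<=` measurable.
  apply: smallest_sub; first exact: sigma_algebra_measurable.
  case: n => [|n] in f mf *; first by rewrite big_ord0.
  rewrite -bigcup_mkord_ord; apply: bigcup_sub => i Ii.
  by move=> A [B mB <-]; exact: mf.
rewrite g_sigma_preimage_comp in sub.
by move=> _ A mA; apply: sub; exists A.
Qed.

Lemma product_measure1_sigma_finite d1 d2 (T1 : measurableType d1)
    (T2 : measurableType d2) (R : realType)
    (m1 : {sigma_finite_measure set T1 -> \bar R})
    (m2 : {sigma_finite_measure set T2 -> \bar R}) :
  sigma_finite [set: T1 * T2] (m1 \x m2)%E.
Proof.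
have /sigma_finiteP[F [TF ndF Foo]] := sigma_finiteT m1.
have /sigma_finiteP[G [TG ndG Goo]] := sigma_finiteT m2.
exists (fun n => F n `*` G n).
  rewrite -setXTT TF TG predeqE => -[x y]; split.
    move=> [/= [n _ Fnx] [k _ Gky]]; exists (maxn n k) => //; split.
    - by move: x Fnx; exact/subsetPset/ndF/leq_maxl.
    - by move: y Gky; exact/subsetPset/ndG/leq_maxr.
  by move=> [n _ []/= ? ?]; split; exists n.
move=> k; have [? ?] := Foo k; have [? ?] := Goo k.
split; first exact: measurableX.
by rewrite product_measure1E// lte_mul_pinfty// ge0_fin_numE.
Qed.

Section lebesgue_rV_succ.
Context {R : realType} (n : nat).
Variable m : {sigma_finite_measure set 'rV[R]_n -> \bar R}.

Definition rV_cons (z : R * 'rV[R]_n) : 'rV[R]_n.+1 :=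
  row_mx (const_mx z.1 : 'rV_1) z.2.

Definition rV_uncons (v : 'rV[R]_n.+1) : R * 'rV[R]_n :=
  (v ord0 ord0, @rsubmx R 1 1 n v).

Lemma rV_consK : cancel rV_cons rV_uncons.
Proof.
case=> a v; rewrite /rV_uncons /rV_cons/=; congr pair; last exact: row_mxKr.
transitivity ((row_mx (const_mx a : 'rV_1) v) ord0 (lshift n ord0)).
  by congr (row_mx _ _ _ _); exact: ord_inj.
by rewrite row_mxEl mxE.
Qed.

Lemma measurable_rV_cons : measurable_fun setT rV_cons.
Proof.
apply: measurable_fun_rVP => i.
case: (@split_ordP 1 n i) => j ->.
  rewrite (_ : _ \o _ = fst)//; apply/funext => z.
  by rewrite [LHS](row_mxEl _ _ ord0 j) mxE.
rewrite (_ : _ \o _ = rV_coor j \o snd).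
  by apply: measurableT_comp => //; exact: measurable_rV_coor.
by apply/funext => z; rewrite [LHS](row_mxEr _ _ ord0 j).
Qed.

Lemma measurable_rV_uncons : measurable_fun setT rV_uncons.
Proof.
apply/measurable_fun_pairP; split; first exact: (@measurable_rV_coor R n.+1 ord0).
apply: measurable_fun_rVP => i.
rewrite (_ : _ \o _ = @rV_coor R n.+1 (@rshift 1 n i)).
  exact: measurable_rV_coor.
by apply/funext => v /=; rewrite /rV_coor /rV_uncons/= mxE.
Qed.

Definition lebesgue_rV_succ : set 'rV[R]_n.+1 -> \bar R :=
  pushforward (lebesgue_measure \x m)%E rV_cons.

HB.instance Definition _ := Measure.copy lebesgue_rV_succ
  (measure_function_pushforward__canonical__measure_function_Measure
    (lebesgue_measure \x m)%E measurable_rV_cons).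

Let lebesgue_rV_succ_sigma_finite : sigma_finite setT lebesgue_rV_succ.
Proof.
have [F FT mF] := product_measure1_sigma_finite (@lebesgue_measure R) m.
exists (fun k => rV_uncons @^-1` F k).
  by rewrite -preimage_bigcup -FT.
move=> k; have [mFk Fk] := mF k; split.
  by rewrite -[X in measurable X]setTI; exact: measurable_rV_uncons.
rewrite /lebesgue_rV_succ /pushforward -comp_preimage.
rewrite (_ : _ \o _ = id) ?preimage_id//.
by apply/funext => z; exact: rV_consK.
Qed.

HB.instance Definition _ := Measure_isSigmaFinite.Build _ _ _
  lebesgue_rV_succ lebesgue_rV_succ_sigma_finite.

End lebesgue_rV_succ.

(* Lebesgue measure on R^n, the n-fold product of lebesgue_measure. *)
Fixpoint lebesgue_rV (R : realType) (n : nat) :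
    {sigma_finite_measure set 'rV[R]_n -> \bar R} :=
  match n with
  | 0%N => \d_ (0 : 'rV[R]_0)
  | n'.+1 => lebesgue_rV_succ (lebesgue_rV R n')
  end.

(* The norm `|_| that the library puts on 'rV[R]_n is the sup norm. *)
Definition enorm {R : realType} {n : nat} (t : 'rV[R]_n) : R :=
  Num.sqrt (\sum_(i < n) t ord0 i ^+ 2).

Definition eball (R : realType) (n : nat) (r : R) : set 'rV[R]_n :=
  [set t | enorm t < r].

(* (0, +oo), with the Borel sigma-algebra it inherits from R. *)
Definition posR (R : realType) : Type := {posnum R}.

Section posR_measurable.
Context {R : realType}.

HB.instance Definition _ := Choice.copy (posR R) {posnum R}.
HB.instance Definition _ := isPointed.Build (posR R) (1%:pos : {posnum R}).

Definition posR_val (y : posR R) : R := y%:num.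

HB.instance Definition _ :=
  Measurable.copy (posR R) (g_sigma_algebra_preimageType posR_val).

End posR_measurable.

Section dilation_measure.
Context {R : realType} (n : nat).

(* dy / y^{n+1} on (0, +oo) *)
Definition dilation_measure (B : set (posR R)) : \bar R :=
  \int[lebesgue_measure]_(y in posR_val @` B) (y ^- n.+1)%:E.

Lemma posR_image (C : set R) : posR_val @` (posR_val @^-1` C) = C `&` `]0, +oo[.
Proof.
apply/seteqP; split=> [_ [y Cy <-]|y [Cy]] /=.
  by split => //; rewrite in_itv/= andbT /posR_val.
by rewrite in_itv/= andbT => y0; exists (PosNum y0).
Qed.

Lemma measurable_posR_image (B : set (posR R)) :
  measurable B -> measurable (posR_val @` B).
Proof.
move=> [C mC <-]; rewrite setTI posR_image.
by apply: measurableI => //; exact: measurable_itv.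
Qed.

Let measurable_density :
  measurable_fun (`]0, +oo[%classic : set R) (fun y : R => y ^- n.+1).
Proof.
apply: open_continuous_measurable_fun => //.
move=> y; rewrite inE/= in_itv/= andbT => y0.
apply: (@cvgV _ _ _ _ (fun z : R => z ^+ n.+1)); last exact: exprn_continuous.
by rewrite expf_eq0/= gt_eqF.
Qed.

Let posR_image_sub (B : set (posR R)) : posR_val @` B `<=` `]0, +oo[.
Proof. by move=> _ [y _ <-] /=; rewrite in_itv/= andbT /posR_val. Qed.

Let density_ge0 (B : set (posR R)) (y : R) :
  (posR_val @` B) y -> (0 <= (y ^- n.+1)%:E)%E.
Proof.
move=> /posR_image_sub/=; rewrite in_itv/= andbT => y0.
by rewrite lee_fin invr_ge0 exprn_ge0// ltW.
Qed.

Let dilation0 : dilation_measure set0 = 0.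
Proof. by rewrite /dilation_measure image_set0 integral_set0. Qed.

Let dilation_ge0 B : (0 <= dilation_measure B)%E.
Proof. by apply: integral_ge0 => y; exact: density_ge0. Qed.

Let dilation_sigma_additive : semi_sigma_additive dilation_measure.
Proof.
move=> F mF tF mUF; rewrite /dilation_measure image_bigcup.
rewrite ge0_integral_bigcup//=.
- apply: is_cvg_ereal_nneg_natsum_cond => k _ _.
  by apply: integral_ge0 => y; exact: density_ge0.
- by move=> k; exact: measurable_posR_image.
- apply/measurable_EFinP; apply: (measurable_funS _ _ measurable_density).
    exact: measurable_itv.
  by apply: bigcup_sub => k _; exact: posR_image_sub.
- by move=> y [k _]; exact: density_ge0.
- move=> i j _ _ [_ [[x Fx <-] [y Fy /eqP]]].
  rewrite /posR_val -[_ == _]/(y == x) => /eqP yx.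
  by apply: tF => //; exists x; split => //; rewrite -yx.
Qed.

HB.instance Definition _ := isMeasure.Build _ _ _ dilation_measure
  dilation0 dilation_ge0 dilation_sigma_additive.

Let dilation_sigma_finite : sigma_finite setT dilation_measure.
Proof.
pose C (k : nat) := `[k.+1%:R^-1, k.+1%:R]%classic : set R.
exists (fun k => posR_val @^-1` C k).
  apply/esym; rewrite -subTset => y _.
  have y0 : 0 < posR_val y by rewrite /posR_val.
  pose N := (Num.trunc (Num.max (posR_val y) (posR_val y)^-1)).
  have yN : Num.max (posR_val y) (posR_val y)^-1 < N.+1%:R by exact: truncnS_gt.
  exists N => //=; rewrite /C/= in_itv/=.
  move: yN; rewrite gt_max => /andP[yN yVN].
  rewrite (ltW yN) andbT -[leRHS]invrK lef_pV2 ?posrE ?invr_gt0//.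
  exact: ltW.
move=> k; have Cm : measurable (C k) by exact: measurable_itv.
split; first by exists (C k) => //; rewrite setTI.
rewrite /dilation_measure posR_image.
have -> : C k `&` `]0, +oo[ = C k.
  apply/setIidl => y; rewrite /C/= !in_itv/= andbT => /andP[+ _].
  by apply: lt_le_trans; rewrite invr_gt0.
apply: (@le_lt_trans _ _
  (\int[lebesgue_measure]_(y in C k) (cst (k.+1%:R ^+ n.+1)%:E y))%E).
  have C0 y : C k y -> 0 < y.
    rewrite /C/= in_itv/= => /andP[+ _].
    by apply: lt_le_trans; rewrite invr_gt0.
  apply: ge0_le_integral => //=.
  - by move=> y /C0 y0; rewrite lee_fin invr_ge0 exprn_ge0// ltW.
  - apply/measurable_EFinP; apply: (measurable_funS _ _ measurable_density).
      exact: measurable_itv.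
    by move=> y /C0; rewrite /= in_itv/= andbT.
  - move=> y Cy; have y0 := C0 _ Cy; rewrite lee_fin -exprVn.
    apply: lerXn2r; rewrite ?nnegrE ?invr_ge0 ?ler0n ?(ltW y0)//.
    rewrite -[leRHS]invrK lef_pV2 ?posrE ?invr_gt0//.
    by move: Cy; rewrite /C/= in_itv/= => /andP[].
rewrite integral_cst//= /C lebesgue_measure_itv/=.
by case: ifP => _; rewrite ?mule0// -EFinD -EFinM ltry.
Qed.

HB.instance Definition _ := Measure_isSigmaFinite.Build _ _ _
  dilation_measure dilation_sigma_finite.

End dilation_measure.


Notation Gn R n := ('rV[R]_n * posR R)%type.

(* The left Haar measure dx dy / y^{n+1} of the group law
   (x, y) (x', y') = (x + y x', y y'). *)
Definition haar_Gn (R : realType) (n : nat) :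
    {measure set (Gn R n) -> \bar R} :=
  (lebesgue_rV R n \x dilation_measure n)%E.

Definition maximal_trans {R : realType} {n : nat} (f : Gn R n -> R)
    (z : Gn R n) : \bar R :=
  ereal_sup [set (lebesgue_rV R n (@eball R n r))^-1 *
      \int[lebesgue_rV R n]_(t in @eball R n r)
        `|f (z.1 + posR_val z.2 *: t, z.2)|%:E
    | r in [set r : R | (0 < r)%R]]%E.

(* Main.v *)
Require Import Defs.
From mathcomp Require Import all_boot all_order all_algebra.
From mathcomp Require Import all_classical all_reals all_analysis.
From mathcomp Require Import measurable_realfun ess_sup_inf ring lra.
Import Order.TTheory GRing.Theory Num.Theory.
Import numFieldNormedType.Exports.

(** For fixed [y] the operator only averages over balls of the slice
    [f (., y)]: substituting [u = x + y t] turns the mean over [B_r] into the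
    mean over the ball of radius [y r] centred at [x].  So it is the
    Hardy-Littlewood operator of R^n acting slice by slice, with constants that
    do not depend on [y], and the group structure disappears after Fubini.

    Weak type (1,1).  A Euclidean ball and the cube containing it have
    comparable volumes ([eball_volume]), so cubes may replace balls.  If the
    mean of [g >= 0] over a cube centred at [x] is large, so is its mean over
    some rational cube containing [x]; hence the level set is covered by
    countably many heavy cubes, and a Vitali selection in finitely many of them
    bounds the measure of their union ([weak_type_cubes]).
    [maximal_trans_weak_type] integrates this bound over [y]; the integration
    requires the maximal function to be jointly measurable
    ([measurable_maximal_trans]), which holds because rational radii suffice.

    L^p for p > 1.  Discarding the values of [f] of modulus at most [a] lowers
    the maximal function by at most [a], so the weak type bound improves to
    [mu {M f > a + l} <= (C / l) * (integral of |f| over {|f| > a})]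
    ([maximal_trans_weak_type_truncated]).  For [a] the essential supremum
    of [|f|] the right-hand side vanishes, which is the case p = oo.  For
    [a = l], summing over dyadic levels [l] gives the case of finite p, by
    Marcinkiewicz's argument ([marcinkiewicz]).

    Failure for p = 1.  Let [f] be the indicator of [[0, 1)^n x [1, 2]].  On
    [[2^k, 2^(k+1))^n x [1, 2]] the maximal function is at least a constant
    times [2^(-k n)], while the measure of this set is a constant times
    [2^(k n)].  Each [k] thus contributes at least a fixed positive amount to
    the L^1 norm of the maximal function, which is infinite. *)

Set Implicit Arguments.
Unset Strict Implicit.
Unset Printing Implicit Defensive.

Local Open Scope classical_set_scope.
Local Open Scope ring_scope.
Local Open Scope ereal_scope.

(** * Cubes, Euclidean balls and affine maps in R^n *)

Definition affine (R : realType) (V : lmodType R) (x : V) (a : R) (t : V) : V :=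
  (x + a *: t)%R.

(** These are the balls of the sup norm, of side [2 r]. *)
Definition cube (R : realType) (n : nat) (x : 'rV[R]_n) (r : R) :
    set 'rV[R]_n :=
  [set v | forall i, (`|v ord0 i - x ord0 i| < r)%R].

Lemma measurable_rV_bigcap (R : realType) n (B : 'I_n -> set R) :
  (forall i, measurable (B i)) ->
  measurable [set v : 'rV[R]_n | forall i, B i (v ord0 i)].
Proof.
move=> mB.
rewrite (_ : [set _ | _] =
    \big[setI/setT]_(i < n) ((@rV_coor R n i) @^-1` B i)).
  apply: bigsetI_measurable => i _; rewrite -[X in measurable X]setTI.
  exact: measurable_rV_coor.
by rewrite -bigcap_seq; apply/seteqP; split=> v /= Bv i; [move=> _|];
  apply: Bv; rewrite /= mem_index_enum.
Qed.

Lemma measurable_cube (R : realType) n (x : 'rV[R]_n) r : measurable (cube x r).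
Proof.
apply: (@measurable_rV_bigcap _ _ (fun i => [set v | `|v - x ord0 i| < r]%R)).
move=> i; rewrite (_ : [set _ | _] = ball (x ord0 i) r).
  exact: measurable_ball.
by apply/seteqP; split=> v /=; rewrite /ball/= distrC.
Qed.

(** Induction on [n]: splitting off the first coordinate writes a box as a
    product of an interval and a box of one dimension less.  A common length
    [c] for all the sides suffices for cubes. *)
Lemma lebesgue_rV_box (R : realType) n (B : 'I_n -> set R) (c : R) :
  (forall i, measurable (B i)) ->
  (forall i, lebesgue_measure (B i) = c%:E) ->
  lebesgue_rV R n [set v | forall i, B i (v ord0 i)] = (c ^+ n)%:E.
Proof.
elim: n B => [|n IH] B mB cB.
  by rewrite /= diracE mem_set//= => -[].
rewrite [LHS]/= /lebesgue_rV_succ /pushforward.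
rewrite (_ : _ @^-1` _ = B ord0 `*`
    [set v : 'rV[R]_n | forall i, B (lift ord0 i) (v ord0 i)]).
  rewrite product_measure1E; [|exact: mB|].
    rewrite exprS EFinM; congr (_ * _); first exact: cB.
    by apply: (IH (fun i => B (lift ord0 i))) => i; [exact: mB|exact: cB].
  by apply: (@measurable_rV_bigcap _ _ (fun i => B (lift ord0 i))) => i; exact: mB.
have E0 (z : R * 'rV[R]_n) : rV_cons z ord0 ord0 = z.1.
  by rewrite -[in RHS](rV_consK z).
have El (z : R * 'rV[R]_n) i : rV_cons z ord0 (lift ord0 i) = z.2 ord0 i.
  rewrite /rV_cons (_ : lift ord0 i = @rshift 1 n i); last exact: val_inj.
  exact: (row_mxEr _ _ ord0 i).
apply/seteqP; split=> [z /= zB|z /= [z1 z2] i].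
  by split=> [|i]; [rewrite -E0|rewrite -El].
by case: (unliftP ord0 i) => [j|] ->; [rewrite El|rewrite E0].
Qed.

Lemma lebesgue_rV_cube (R : realType) n (x : 'rV[R]_n) r : (0 <= r)%R ->
  lebesgue_rV R n (cube x r) = ((r *+ 2) ^+ n)%:E.
Proof.
move=> r0.
apply: (@lebesgue_rV_box _ _ (fun i => [set v | `|v - x ord0 i| < r]%R)) => i.
  rewrite (_ : [set _ | _] = ball (x ord0 i) r); first exact: measurable_ball.
  by apply/seteqP; split=> v /=; rewrite /ball/= distrC.
rewrite (_ : [set _ | _] = ball (x ord0 i) r); first exact: lebesgue_measure_ball.
by apply/seteqP; split=> v /=; rewrite /ball/= distrC.
Qed.

Lemma measurable_eball (R : realType) n r : measurable (@eball R n r).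
Proof.
rewrite (_ : @eball R n r = enorm @^-1` [set x : R | x < r]%R)//.
rewrite -[X in measurable X]setTI.
have mN : measurable_fun [set: 'rV[R]_n] enorm.
  apply: (@measurableT_comp _ _ _ _ _ _ (@Num.sqrt R)).
    by apply: continuous_measurable_fun => ?; exact: sqrt_continuous.
  apply: measurable_sum => i; apply: measurable_funX.
  exact: measurable_rV_coor.
by apply: mN => //; rewrite -set_itvNyo; exact: measurable_itv.
Qed.

Lemma eball_sub_cube (R : realType) n (r : R) : @eball R n r `<=` cube 0%R r.
Proof.
move=> t /= tr i; rewrite mxE subr0; apply: le_lt_trans tr.
rewrite /enorm -sqrtr_sqr ler_wsqrtr// (bigD1 i)//= lerDl.
by apply: sumr_ge0 => j _; exact: sqr_ge0.
Qed.

(** The Euclidean norm is at most [sqrt n] times the sup norm; [n.+1] is a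
    cruder factor, which stays positive when [n = 0]. *)
Lemma cube_sub_eball (R : realType) n (r : R) :
  (0 < r)%R -> cube (0%R : 'rV[R]_n) r `<=` @eball R n (n.+1%:R * r)%R.
Proof.
move=> r0 t /= tr; rewrite /eball/= /enorm.
have nr0 : (0 < n.+1%:R * r)%R by rewrite mulr_gt0.
rewrite -[ltRHS]gtr0_norm// -sqrtr_sqr ltr_sqrt ?exprn_gt0//.
apply: (@le_lt_trans _ _ (\sum_(i < n) r ^+ 2)%R).
  apply: ler_sum => i _; rewrite -real_normK ?num_real//.
  by rewrite lerXn2r ?nnegrE ?(ltW r0)//; have := ltW (tr i); rewrite mxE subr0.
rewrite sumr_const card_ord exprMn -(mulr_natl (r ^+ 2) n) ltr_pM2r ?exprn_gt0//.
by rewrite -natrX ltr_nat expnS expn1 leq_pmulr.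
Qed.

(** The measure structure on [pushforward m f] depends on a proof that [f] is
    measurable, so it has to be given explicitly. *)
Definition pushforward_measure d1 d2 (T1 : measurableType d1)
    (T2 : measurableType d2) (R : realType) (m : {measure set T1 -> \bar R})
    (f : T1 -> T2) (mf : measurable_fun setT f) :
    {measure set T2 -> \bar R} :=
  measure_function_pushforward__canonical__measure_function_Measure m mf.

Lemma measurable_fun_affine (R : realType) n (x : 'rV[R]_n) a :
  measurable_fun setT (affine x a).
Proof.
apply: measurable_fun_rVP => i.
rewrite (_ : _ \o _ = fun v => (x ord0 i + a * rV_coor i v)%R).
  apply: measurable_funD => //; apply: measurable_funM => //.
  exact: measurable_rV_coor.
by apply/funext => v; rewrite /= /rV_coor /affine !mxE.
Qed.

Lemma lebesgue_measure_affine (R : realType) (x a : R) (A : set R) :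
  (0 < a)%R -> measurable A ->
  lebesgue_measure (@affine R R^o x a @^-1` A) = a^-1%:E * lebesgue_measure A.
Proof.
move=> a0 mA.
pose f : measurableTypeR R -> measurableTypeR R := @affine R R^o x a.
have mf : measurable_fun setT f.
  by apply: measurable_funD => //; exact: measurable_funM.
pose nu := mscale (NngNum (ltW a0)) (pushforward_measure lebesgue_measure mf).
have nuE X : ocitv X -> lebesgue_measure X = nu X.
  move=> [[c d]] _ <-; rewrite /nu /mscale/= /pushforward.
  rewrite (_ : f @^-1` _ = `]((c - x) / a)%R, ((d - x) / a)%R]%classic); last first.
    apply/seteqP; split=> v /=; rewrite /f /affine !in_itv/= ltr_pdivrMr//;
      by rewrite ler_pdivlMr// [(v * a)%R]mulrC ltrBlDl lerBrDl.
  rewrite !lebesgue_measure_itv/= !lte_fin ltr_pM2r ?invr_gt0// ltrD2r.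
  case: ifPn => _; last by rewrite mule0.
  by rewrite -!EFinD -EFinM -mulrBl opprB addrA subrK mulrCA divff ?mulr1// gt_eqF.
by rewrite (lebesgue_measure_unique nuE mA) /nu /mscale/= /pushforward muleA
  -EFinM mulVf ?mul1e// gt_eqF.
Qed.

Lemma mule_cancel (R : realType) (u v w : R) (x y : \bar R) :
  (u * v * w)%R = 1%R -> u%:E * ((v%:E * x) * (w%:E * y)) = x * y.
Proof. by move=> uvw; rewrite muleACA !muleA -!EFinM uvw mul1e. Qed.

(** Up to the factor [a ^ n.+1], pushing [lebesgue_measure \x m] forward along
    the map that acts affinely on each factor gives a measure that has the
    values of [lebesgue_measure \x m] on rectangles; a product measure is
    determined by these. *)
Lemma lebesgue_rV_affine (R : realType) n (x : 'rV[R]_n) (a : R) A :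
  (0 < a)%R -> measurable A ->
  lebesgue_rV R n (affine x a @^-1` A) = (a ^- n)%:E * lebesgue_rV R n A.
Proof.
move=> a0; elim: n x A => [|n IH] x A mA.
  rewrite /= invr1 mul1e; congr (dirac _ _).
  by apply/seteqP; split => v /=; rewrite [affine _ _ _]thinmx0 [v]thinmx0.
set m := lebesgue_rV R n in IH *.
pose x0 := (rV_uncons x).1; pose x' := (rV_uncons x).2.
pose f : measurableTypeR R -> measurableTypeR R := @affine R R^o x0 a.
have mf : measurable_fun setT f.
  by apply: measurable_funD => //; exact: measurable_funM.
pose g (z : measurableTypeR R * 'rV[R]_n) : measurableTypeR R * 'rV[R]_n :=
  (f z.1, affine x' a z.2).
have mg : measurable_fun setT g.
  apply/measurable_fun_pairP; split; first exact: (measurableT_comp mf).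
  exact: (measurableT_comp (@measurable_fun_affine R n x' a)).
have an0 : (0 <= a ^+ n.+1)%R by rewrite exprn_ge0// ltW.
pose nu := mscale (NngNum an0) (pushforward_measure (lebesgue_measure \x m) mg).
have nuE B C : measurable B -> measurable C ->
    nu (B `*` C) = (@lebesgue_measure R) B * m C.
  move=> mB mC; rewrite /nu /mscale/= /pushforward.
  rewrite (_ : g @^-1` _ = (f @^-1` B) `*` (affine x' a @^-1` C))//.
  rewrite product_measure1E//; last 2 first.
    by rewrite -[X in measurable X]setTI; exact: mf.
    by rewrite -[X in measurable X]setTI; exact: measurable_fun_affine.
  have L1 : lebesgue_measure (f @^-1` B) = _ := lebesgue_measure_affine x0 a0 mB.
  transitivity ((a ^+ n.+1)%:E *
    ((a^-1%:E * (@lebesgue_measure R) B) * ((a ^- n)%:E * m C))).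
    by congr (_ * (_ * _)); [exact: L1|exact: IH].
  apply: mule_cancel; rewrite -mulrA -invfM -exprS divff//.
  by rewrite expf_neq0// gt_eqF.
have gE : @rV_cons R n @^-1` (affine x a @^-1` A) = g @^-1` (@rV_cons R n @^-1` A).
  rewrite -!(comp_preimage _ (@rV_cons R n)); congr (_ @^-1` A).
  apply/funext => z /=; apply/rowP => i; rewrite /affine !mxE.
  case: (@split_ordP 1 n i) => j ->; rewrite ?row_mxEl ?row_mxEr !mxE//.
  by congr (x _ _ + _)%R; apply: val_inj; rewrite /= ord1.
have mA' : measurable (@rV_cons R n @^-1` A).
  by rewrite -[X in measurable X]setTI; exact: measurable_rV_cons.
have -> : lebesgue_rV R n.+1 A = (@lebesgue_measure R \x m) (@rV_cons R n @^-1` A) by [].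
have -> : lebesgue_rV R n.+1 (affine x a @^-1` A) =
  (@lebesgue_measure R \x m) (g @^-1` (@rV_cons R n @^-1` A)) by rewrite -gE.
rewrite (product_measure_unique nuE mA') /nu /mscale/= /pushforward.
by rewrite muleA -EFinM mulVf ?mul1e// expf_neq0// gt_eqF.
Qed.

Lemma ge0_integral_affine (R : realType) n (x : 'rV[R]_n) (a : R)
    (D : set 'rV[R]_n) (g : 'rV[R]_n -> \bar R) :
  (0 < a)%R -> measurable D -> measurable_fun setT g -> (forall v, 0 <= g v) ->
  \int[lebesgue_rV R n]_(t in affine x a @^-1` D) g (affine x a t) =
  (a ^- n)%:E * \int[lebesgue_rV R n]_(t in D) g t.
Proof.
move=> a0 mD mg g0.
have mf := @measurable_fun_affine R n x a.
have an0 : (0 <= a ^- n)%R by rewrite invr_ge0 exprn_ge0// ltW.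
rewrite -[LHS](ge0_integral_pushforward mf)//; last exact: measurable_funTS.
rewrite -(ge0_integral_mscale _ mD (NngNum an0))//; last exact: measurable_funTS.
apply: (eq_measure_integral (mscale (NngNum an0) (lebesgue_rV R n))) => A mA _.
exact: lebesgue_rV_affine.
Qed.

(** * Covering by cubes and the weak type bound on R^n *)

Lemma cube_tripled (R : realType) n (x y : 'rV[R]_n) (r s : R) : (s <= r)%R ->
  cube y s `&` cube x r !=set0 -> cube y s `<=` cube x (3 * r)%R.
Proof.
move=> sr [w [yw xw]] v yv i.
have := yw i; have := xw i; have := yv i.
rewrite !ltr_norml => /andP[? ?] /andP[? ?] /andP[? ?]; apply/andP; split; lra.
Qed.

(** Greedy selection: keep a cube [p] of maximal radius, discard the cubes that
    meet it, and recurse on the others.  A discarded cube is no larger than [p]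
    and meets it, so that tripling [p] swallows it. *)
Lemma vitali_cube (R : realType) n (s : seq ('rV[R]_n * R)) :
  (forall p, p \in s -> (0 < p.2)%R) ->
  exists D : seq ('rV[R]_n * R), [/\ uniq D, {subset D <= s},
    trivIset [set` D] (fun p => cube p.1 p.2) &
    forall p, p \in s ->
      exists2 q, q \in D & cube p.1 p.2 `<=` cube q.1 (3 * q.2)%R].
Proof.
have [N sN] := ubnP (size s); elim: N => // N IH in s sN *.
move=> s0; have [->|/eqP sn0] := eqVneq s [::].
  by exists [::]; split => // p q /=.
have [p ps pmax] : exists2 p, p \in s & forall q, q \in s -> (q.2 <= p.2)%R.
  elim: s sn0 {sN s0} => // p [|q s] IHs _.
    by exists p; rewrite ?mem_head// => q; rewrite inE => /eqP ->.
  have [//|m ms mmax] := IHs.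
  have [mp|/ltW pm] := leP m.2 p.2.
    exists p; first exact: mem_head.
    move=> t; rewrite inE => /predU1P[->//|/mmax /le_trans]; exact.
  exists m; first by rewrite inE ms orbT.
  by move=> t; rewrite inE => /predU1P[->//|/mmax].
(* [far] selects the cubes that survive the choice of [p]; [p] meets itself,
   hence is not among them and the list gets shorter. *)
pose far q := `[< cube q.1 q.2 `&` cube p.1 p.2 = set0 >].
have Npp : ~~ far p.
  apply/negP => /asboolP; apply/eqP/set0P; exists p.1.
  by split=> i; rewrite subrr normr0 s0.
have [||D [uD Ds tD coverD]] := IH [seq q <- s | far q].
- rewrite -ltnS; apply: leq_trans sN; rewrite ltnS size_filter.
  rewrite -(count_predC far) -[ltnLHS]addn0 ltn_add2l -has_count.
  by apply/hasP; exists p.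
- by move=> q; rewrite mem_filter => /andP[_]; exact: s0.
have farD q : q \in D -> far q by move=> /Ds; rewrite mem_filter => /andP[].
exists (p :: D); split.
- by rewrite /= uD andbT; apply: contra Npp; exact: farD.
- move=> q; rewrite inE => /predU1P[->//|/Ds].
  by rewrite mem_filter => /andP[].
- move=> q q'; rewrite /= !inE => /predU1P[->|qD] /predU1P[->|q'D] //.
  + by rewrite setIC => /set0P/eqP; have /asboolP := farD _ q'D.
  + by move=> /set0P/eqP; have /asboolP := farD _ qD.
  + by apply: tD.
- move=> q qs; have [farq|/asboolP /eqP/set0P qp] := boolP (far q).
    have [|t tD' qt] := coverD q; first by rewrite mem_filter farq.
    by exists t; rewrite // inE tD' orbT.
  by exists p; [rewrite mem_head|apply: cube_tripled => //; exact: pmax].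
Qed.

Lemma measure_bigsetU_le d (T : measurableType d) (R : realType)
    (m : {measure set T -> \bar R}) (I : Type) (s : seq I) (A : I -> set T) :
  (forall i, measurable (A i)) ->
  m (\big[setU/set0]_(i <- s) A i) <= \sum_(i <- s) m (A i).
Proof.
move=> mA; elim: s => [|i s IH]; first by rewrite !big_nil measure0.
rewrite !big_cons; apply: le_trans (measureU2 _ _ _) _ => //.
  by apply: bigsetU_measurable => j _; exact: mA.
by rewrite leeD2l.
Qed.

Section weak_type_cubes.
Variables (R : realType) (n : nat) (g : 'rV[R]_n -> \bar R) (k : R).
Hypotheses (mg : measurable_fun setT g) (g0 : forall x, 0 <= g x) (k0 : (0 < k)%R).
Local Notation mu := (lebesgue_rV R n).

(** The mean of [g] over the cube exceeds [k], stated without a division. *)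
Definition heavy (p : 'rV[R]_n * R) : Prop :=
  (0 < p.2)%R /\ (k * (p.2 *+ 2) ^+ n)%:E < \int[mu]_(x in cube p.1 p.2) g x.

(** The selected cubes are disjoint and each of them carries a [g]-mass of more
    than [k] times its volume; tripling them costs the factor [3 ^ n]. *)
Lemma lebesgue_rV_heavy_cubes (s : seq ('rV[R]_n * R)) :
  (forall p, p \in s -> heavy p) ->
  mu (\big[setU/set0]_(p <- s) cube p.1 p.2) <= (3 ^+ n / k)%:E * \int[mu]_x g x.
Proof.
move=> hs; have [|D [uD Ds tD coverD]] := @vitali_cube _ _ s.
  by move=> p /hs[].
have mcube (p : 'rV[R]_n * R) : measurable (cube p.1 p.2).
  exact: measurable_cube.
apply: (@le_trans _ _ (mu (\big[setU/set0]_(p <- D) cube p.1 (3 * p.2)%R))).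
  apply: le_measure; rewrite ?inE.
  - exact: bigsetU_measurable.
  - by apply: bigsetU_measurable => p _; exact: measurable_cube.
  - rewrite -!bigcup_seq => x [p /= ps xp]; have [q qD pq] := coverD p ps.
    by exists q => //; exact: pq.
apply: le_trans (measure_bigsetU_le _ _ _) _.
  by move=> p; exact: measurable_cube.
apply: (@le_trans _ _ (\sum_(p <- D)
    (3 ^+ n / k)%:E * \int[mu]_(x in cube p.1 p.2) g x)).
  rewrite big_seq [leRHS]big_seq; apply: lee_sum => p /Ds /hs[p0 hp].
  rewrite [leLHS]lebesgue_rV_cube; last by rewrite mulr_ge0 ?(ltW p0).
  apply: (@le_trans _ _ ((3 ^+ n / k)%:E * (k * (p.2 *+ 2) ^+ n)%:E)).
    by rewrite -EFinM mulrA divfK ?gt_eqF// -exprMn mulrnAr.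
  by rewrite lee_pmul2l ?(ltW hp)// lte_fin divr_gt0// exprn_gt0.
rewrite -ge0_sume_distrr; last by move=> p _; exact: integral_ge0.
rewrite lee_pmul2l//; last by rewrite lte_fin divr_gt0// exprn_gt0.
rewrite -ge0_integral_bigsetU//.
- apply: ge0_subset_integral => //; exact: bigsetU_measurable.
- exact: measurable_funTS.
Qed.

(** The price for a rational centre and a rational radius is at most a doubling
    of the radius. *)
Lemma rational_cube (x : 'rV[R]_n) (r : R) : (0 < r)%R ->
  exists q : 'rV[rat]_n * rat,
    let y := map_mx ratr q.1 in let s := ratr q.2 in
    [/\ (0 < s)%R, (s <= r *+ 2)%R, cube y s x & cube x r `<=` cube y s].
Proof.
move=> r0; have [|s] := @rat_in_itvoo R r (r *+ 2)%R.
  by rewrite mulr2n ltrDl.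
rewrite in_itv/= => /andP[rs s2r].
have qP i : exists q : rat, (`|ratr q - x ord0 i| < ratr s - r)%R.
  have [|q] := @rat_in_itvoo R (x ord0 i) (x ord0 i + (ratr s - r))%R.
    by rewrite ltrDl subr_gt0.
  rewrite in_itv/= => /andP[xq qx]; exists q.
  by rewrite ger0_norm ?subr_ge0 ?ltW// ltrBlDl.
have [q qE] := choice qP.
exists (\row_i q i, s) => /=; split; [exact: lt_trans rs|exact: ltW| |].
  by move=> i; rewrite !mxE distrC (lt_trans (qE i))// ltrBlDr ltrDl.
move=> v xv i; rewrite !mxE; have := xv i; have := qE i; rewrite !ltr_norml.
by move=> /andP[? ?] /andP[? ?]; apply/andP; split; lra.
Qed.

(** [E] is covered by the rational heavy cubes, which are countably many: the
    bound for finite unions passes to the increasing union.  The factor [2 ^ n]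
    in the hypothesis pays for the passage to rational cubes. *)
Lemma weak_type_cubes (E : set 'rV[R]_n) : measurable E ->
  (forall x, E x -> exists2 r, (0 < r)%R &
     (2 ^+ n * k * (r *+ 2) ^+ n)%:E < \int[mu]_(x in cube x r) g x) ->
  mu E <= (3 ^+ n / k)%:E * \int[mu]_x g x.
Proof.
move=> mE hE.
pose emb (q : 'rV[rat]_n * rat) : 'rV[R]_n * R := (map_mx ratr q.1, ratr q.2).
pose s N := [seq p <- [seq emb q | q <- pmap unpickle (iota 0 N)] | `[< heavy p >]].
(* [s N] lists the heavy cubes among the first [N] rational ones. *)
pose U N := \big[setU/set0]_(p <- s N) cube p.1 p.2.
have mU N : measurable (U N).
  by apply: bigsetU_measurable => p _; exact: measurable_cube.
have ndU : nondecreasing_seq U.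
  move=> N M NM; apply/subsetPset; rewrite /U -!bigcup_seq => x [p /= ps xp].
  exists p => //=; move: ps; rewrite !mem_filter => /andP[-> /=].
  move=> /mapP[q qN ->]; apply: map_f; move: qN; rewrite !mem_pmap.
  move=> /mapP[j jN ->]; apply: map_f; move: jN.
  by rewrite !mem_iota /= !add0n => /leq_trans; exact.
have EU : E `<=` \bigcup_N U N.
  move=> x /hE[r r0 hr]; have [q [/= q0 qr qx xq]] := rational_cube x r0.
  exists (pickle q).+1 => //; rewrite /U -bigcup_seq; exists (emb q) => //=.
  rewrite mem_filter; apply/andP; split.
    apply/asboolP; split => //=; apply: le_lt_trans (lt_le_trans hr _).
      rewrite lee_fin [(2 ^+ n * k)%R]mulrC -mulrA -exprMn ler_pM2l//.
      rewrite lerXn2r ?nnegrE ?mulr_ge0 ?mulrn_wge0 ?(ltW q0) ?(ltW r0)//.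
      by rewrite mulr_natl lerMn2r qr orbT.
    by apply: ge0_subset_integral => //; [exact: measurable_cube|
      exact: measurable_cube|exact: measurable_funTS].
  apply: map_f; rewrite mem_pmap; apply/mapP; exists (pickle q).
    by rewrite mem_iota /= add0n.
  by rewrite pickleK.
apply: (@le_trans _ _ (mu (\bigcup_N U N))).
  by apply: le_measure; rewrite ?inE//; exact: bigcupT_measurable.
have cvU : (mu \o U) N @[N --> \oo] --> mu (\bigcup_N U N).
  exact: nondecreasing_cvg_mu mU (bigcupT_measurable _ mU) ndU.
rewrite -(cvg_lim _ cvU)//; apply: lime_le; first by apply/cvg_ex; eexists; exact: cvU.
by apply: nearW => N /=; apply: lebesgue_rV_heavy_cubes => p;
  rewrite mem_filter => /andP[/asboolP].
Qed.
End weak_type_cubes.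

(** * Measurability of the maximal function *)

Lemma eball_volume (R : realType) n (r : R) : (0 < r)%R ->
  exists v : R, [/\ (0 < v)%R, lebesgue_rV R n (@eball R n r) = v%:E,
    ((r *+ 2 / n.+1%:R) ^+ n <= v)%R & (v <= (r *+ 2) ^+ n)%R].
Proof.
move=> r0.
have le1 : lebesgue_rV R n (@eball R n r) <= ((r *+ 2) ^+ n)%:E.
  rewrite -(lebesgue_rV_cube (0%R : 'rV[R]_n)) ?(ltW r0)//.
  apply: le_measure; rewrite ?inE; [exact: measurable_eball|
    exact: measurable_cube|exact: eball_sub_cube].
have rn0 : (0 < r / n.+1%:R)%R by rewrite divr_gt0.
have le2 : (((r / n.+1%:R) *+ 2) ^+ n)%:E <= lebesgue_rV R n (@eball R n r).
  rewrite -(lebesgue_rV_cube (0%R : 'rV[R]_n)) ?(ltW rn0)//.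
  apply: le_measure; rewrite ?inE; [exact: measurable_cube|
    exact: measurable_eball|].
  by have := @cube_sub_eball R n _ rn0; rewrite [(n.+1%:R * _)%R]mulrC divfK.
have fin : lebesgue_rV R n (@eball R n r) \is a fin_num.
  by rewrite ge0_fin_numE// (le_lt_trans le1)// ltry.
exists (fine (lebesgue_rV R n (@eball R n r))); split.
- rewrite -lte_fin fineK//; apply: lt_le_trans le2.
  by rewrite lte_fin exprn_gt0// pmulrn_lgt0.
- by rewrite fineK.
- by rewrite -lee_fin fineK// -mulrnAl in le2 *.
- by rewrite -lee_fin fineK.
Qed.

Lemma measurable_posR_val (R : realType) :
  measurable_fun [set: posR R] (@posR_val R).
Proof. by move=> _ Y mY; exists Y. Qed.

Section ball_mean.
Variables (R : realType) (n : nat).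
Local Notation mu := (lebesgue_rV R n).

Definition ball_mean (f : Gn R n -> R) (z : Gn R n) (r : R) : \bar R :=
  (mu (@eball R n r))^-1 *
  \int[mu]_(t in @eball R n r) `|f (affine z.1 (posR_val z.2) t, z.2)|%:E.

Lemma maximal_transE f z :
  maximal_trans f z = ereal_sup [set ball_mean f z r | r in [set r | (0 < r)%R]].
Proof. by []. Qed.

Lemma ball_mean_ge0 f z r : 0 <= ball_mean f z r.
Proof.
by rewrite mule_ge0 ?inve_ge0//; apply: integral_ge0 => t _; rewrite lee_fin.
Qed.

Lemma maximal_trans_ge0 f z : 0 <= @maximal_trans R n f z.
Proof.
apply: le_trans (ball_mean_ge0 f z 1) _.
by apply: ereal_sup_ubound; exists 1%R => /=.
Qed.

Variable f : Gn R n -> R.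
Hypothesis mf : measurable_fun setT f.

Lemma measurable_translate :
  measurable_fun setT (fun w : Gn R n * 'rV[R]_n =>
    (affine w.1.1 (posR_val w.1.2) w.2, w.1.2) : Gn R n).
Proof.
apply/measurable_fun_pairP; split; last exact: (measurableT_comp measurable_snd measurable_fst).
apply: measurable_fun_rVP => i.
rewrite (_ : _ \o _ = fun w : Gn R n * 'rV[R]_n =>
  (rV_coor i w.1.1 + posR_val w.1.2 * rV_coor i w.2)%R); last first.
  by apply/funext => w; rewrite /= /rV_coor /affine !mxE.
have mc := @measurable_rV_coor R n i.
apply: measurable_funD.
  exact: (measurableT_comp mc (measurableT_comp measurable_fst measurable_fst)).
apply: measurable_funM.
  exact: (measurableT_comp (@measurable_posR_val R)
    (measurableT_comp measurable_snd measurable_fst)).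
exact: (measurableT_comp mc measurable_snd).
Qed.

Lemma measurable_slice (y : posR R) :
  measurable_fun setT (fun x : 'rV[R]_n => `|f (x, y)|%:E).
Proof.
apply/measurable_EFinP; apply: measurableT_comp => //.
have mp : measurable_fun setT (fun x : 'rV[R]_n => (x, y)).
  by apply/measurable_fun_pairP; split; [exact: measurable_id|exact: measurable_cst].
exact: (measurableT_comp mf mp).
Qed.

Lemma measurable_translated (z : Gn R n) :
  measurable_fun setT (fun t : 'rV[R]_n =>
    `|f (affine z.1 (posR_val z.2) t, z.2)|%:E).
Proof.
exact: (measurableT_comp (measurable_slice z.2)
  (@measurable_fun_affine R n z.1 (posR_val z.2))).
Qed.

Lemma measurable_ball_mean r : measurable_fun setT (ball_mean f ^~ r).
Proof.
have [v] : exists v : \bar R, (mu (@eball R n r))^-1 = v by eexists.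
rewrite /ball_mean => ->; apply: emeasurable_funM => //.
pose h (w : Gn R n * 'rV[R]_n) : \bar R :=
  (`|f (affine w.1.1 (posR_val w.1.2) w.2, w.1.2)| * \1_(@eball R n r) w.2)%:E.
rewrite (_ : (fun _ => _) = fubini_F mu h); last first.
  apply/funext => z; rewrite integral_mkcond epatch_indic.
  by apply: eq_integral => t _; rewrite /h EFinM.
apply: measurable_fun_fubini_tonelli_F; last first.
  by move=> w; rewrite lee_fin mulr_ge0.
apply/measurable_EFinP; apply: measurable_funM.
  apply: measurableT_comp => //.
  exact: (measurableT_comp mf measurable_translate).
have m1 : measurable_fun setT (\1_(@eball R n r) : 'rV[R]_n -> R).
  by apply: measurable_indic; exact: measurable_eball.
exact: (measurableT_comp m1 measurable_snd).
Qed.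

(** The ball [B_r] is the increasing union of the balls of radii [rk k < r], and
    for a rational [q] between [rk k] and [r] the mean over [B_q] is at least
    the integral over [B_(rk k)] divided by the volume of [B_r]. *)
Lemma ball_mean_rational z r (S : \bar R) : (0 < r)%R ->
  (forall q : rat, (0 < ratr q :> R)%R -> ball_mean f z (ratr q) <= S) ->
  ball_mean f z r <= S.
Proof.
move=> r0 hS.
have S0 : 0 <= S.
  by apply: le_trans (hS 1%R _); [exact: ball_mean_ge0|rewrite rmorph1].
have [v [v0 vE _ _]] := @eball_volume R n r r0.
rewrite /ball_mean vE inver gt_eqF// lee_pdivrMl//.
set g := fun t => _.
have mg : measurable_fun setT g by exact: measurable_translated.
have g0 t : 0 <= g t by rewrite lee_fin.
pose rk (k : nat) : R := (r * (1 - k.+1%:R^-1))%R.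
have rkr k : (rk k < r)%R.
  by rewrite /rk gtr_pMr// gtrBl invr_gt0.
have cv : \int[mu]_(t in @eball R n (rk k)) g t @[k --> \oo] -->
    \int[mu]_(t in \bigcup_k @eball R n (rk k)) g t.
  apply: ge0_nondecreasing_set_cvg_integral => //.
  - move=> i j ij; apply/subsetPset => t /= /lt_le_trans; apply.
    by rewrite ler_pM2l// lerB// lef_pV2 ?posrE// ler_nat.
  - by move=> i; exact: measurable_eball.
  - by move=> i; exact: measurable_funTS.
rewrite (_ : @eball R n r = \bigcup_k @eball R n (rk k)); last first.
  apply/seteqP; split=> t /=; last by move=> [k _ /= /lt_trans]; exact.
  rewrite /eball/= => tr; have /andP[e0 er] : (0 < 1 - enorm t / r <= 1)%R.
    by rewrite subr_gt0 ltr_pdivrMr// mul1r tr/= gerBl divr_ge0 ?(ltW r0)// sqrtr_ge0.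
  (* any [k] with [enorm t < r * (1 - k.+1^-1)], that is
     [(1 - enorm t / r)^-1 < k.+1] *)
  exists (Num.truncn (1 - enorm t / r)^-1) => //=; rewrite /rk.
  rewrite mulrC -ltr_pdivrMr// ltrBrDl -ltrBrDr -[ltRHS]invrK.
  by rewrite ltf_pV2 ?posrE ?invr_gt0// truncnS_gt.
rewrite -(cvg_lim _ cv)//; apply: lime_le; first by apply/cvg_ex; eexists; exact: cv.
apply: nearW => k.
have [|q] := @rat_in_itvoo R (rk k) r; first exact: rkr.
rewrite in_itv/= => /andP[kq qr].
have q0 : (0 < ratr q :> R)%R.
  apply: le_lt_trans kq; rewrite mulr_ge0 ?(ltW r0)// subr_ge0 invf_le1//.
  by rewrite ler1n.
have := hS q q0; rewrite /ball_mean.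
have [u [u0 uE _ _]] := @eball_volume R n _ q0.
rewrite uE inver gt_eqF// lee_pdivrMl// => qS.
have sub (s s' : R) : (s <= s')%R -> @eball R n s `<=` @eball R n s'.
  by move=> ss' t /= /lt_le_trans; exact.
apply: (@le_trans _ _ (u%:E * S)).
  apply: le_trans qS; apply: ge0_subset_integral => //.
  - exact: measurable_eball.
  - exact: measurable_eball.
  - exact: measurable_funTS.
  - exact/sub/ltW.
rewrite lee_wpmul2r// -vE -uE; apply: le_measure; rewrite ?inE.
- exact: measurable_eball.
- exact: measurable_eball.
- exact/sub/ltW.
Qed.

(** The maximal function is the supremum of countably many ball means, those
    with rational radii, and each ball mean is measurable by Tonelli. *)
Lemma measurable_maximal_trans : measurable_fun setT (maximal_trans f).
Proof.
pose u (k : nat) z : \bar R := if (unpickle k : option rat) is Some q then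
  (if (0 < ratr q :> R)%R then ball_mean f z (ratr q) else 0) else 0.
have mu_ k : measurable_fun setT (u k).
  rewrite /u; case: (unpickle k : option rat) => [q|]; last exact: measurable_cst.
  by case: (0 < ratr q :> R)%R; [exact: measurable_ball_mean|exact: measurable_cst].
rewrite (_ : maximal_trans f = fun z => esups (u ^~ z) 0%N).
  exact: measurable_fun_esups.
apply/funext => z; rewrite maximal_transE; apply/eqP; rewrite eq_le.
apply/andP; split; apply: ge_ereal_sup => _ /= [r r0 <-].
  apply: ball_mean_rational => // q q0; apply: ereal_sup_ubound => /=.
  by exists (pickle q) => //; rewrite /u pickleK q0.
rewrite /u; case: (unpickle r : option rat) => [q|]; last exact: maximal_trans_ge0.
case: ifPn => q0; last exact: maximal_trans_ge0.
by apply: ereal_sup_ubound; exists (ratr q).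
Qed.

End ball_mean.

(** * Weak type (1,1) on the group *)

Lemma measurable_super_level d (T : measurableType d) (R : realType)
    (h : T -> R) (a : R) :
  measurable_fun setT h -> measurable [set u | a < h u]%R.
Proof.
move=> mh; rewrite (_ : [set u | _] = h @^-1` `]a, +oo[); last first.
  by apply/seteqP; split=> u /=; rewrite in_itv/= andbT.
by rewrite -[X in measurable X]setTI; apply: mh.
Qed.

Section weak_type.
Variables (R : realType) (n : nat).
Local Notation mu := (lebesgue_rV R n).
Local Notation nu := (dilation_measure n).
Implicit Type f : Gn R n -> R.

(** The product measure is defined by integrating over [x] the measures of the
    [y]-slices; the slicing of the proof is in the other order. *)
Lemma haar_Gn_ysection (A : set (Gn R n)) : measurable A ->
  haar_Gn R n A = \int[nu]_y mu (ysection A y).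
Proof.
move=> mA; transitivity (\int[haar_Gn R n]_z (\1_A z)%:E).
  by rewrite integral_indic ?setIT.
rewrite (fubini_tonelli2 (EFin \o \1_A)).
- by rewrite indic_fubini_tonelli_GE.
- by apply/measurable_EFinP; exact: measurable_indic.
- by move=> z; rewrite lee_fin.
Qed.

Lemma measurable_maximal_level f (c : \bar R) : measurable_fun setT f ->
  measurable [set z | c < maximal_trans f z].
Proof.
move=> mf; rewrite -[X in measurable X]setTI.
by apply: emeasurable_fun_o_infty => //; exact: measurable_maximal_trans.
Qed.

(** The factor [3] comes from the Vitali selection, [2] from the passage to
    rational cubes and [n.+1] from the replacement of balls by cubes. *)
Definition weak_const : R := ((3 * (2 * n.+1%:R)) ^+ n)%R.

Lemma weak_const_gt0 : (0 < weak_const)%R.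
Proof. by rewrite exprn_gt0// !mulr_gt0. Qed.

(** The change of variables [u = x + y t] carries [B_r] into the cube of radius
    [y r] centred at [x]; its Jacobian [y ^ n] is absorbed in the volume of
    that cube, so the constant is the same for all [y]. *)
Lemma ball_mean_cube f (x : 'rV[R]_n) (y : posR R) (l r : R) :
  measurable_fun setT f -> (0 < l)%R -> (0 < r)%R ->
  l%:E < ball_mean f (x, y) r ->
  (l / n.+1%:R ^+ n * ((posR_val y * r) *+ 2) ^+ n)%:E <
    \int[mu]_(t in cube x (posR_val y * r)%R) `|f (t, y)|%:E.
Proof.
move=> mf l0 r0; have y0 : (0 < posR_val y)%R by rewrite /posR_val.
have [v [v0 vE v1 _]] := @eball_volume R n r r0.
rewrite /ball_mean vE inver gt_eqF// lte_pdivlMl//= => lt.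
have mg := measurable_slice mf y.
have maff := @measurable_fun_affine R n x (posR_val y).
have : (v * l)%:E < (posR_val y ^- n)%:E *
    \int[mu]_(t in cube x (posR_val y * r)%R) `|f (t, y)|%:E.
  rewrite -(ge0_integral_affine x y0 (measurable_cube _ _) mg)//.
  apply: lt_le_trans lt _; apply: ge0_subset_integral.
  - exact: measurable_eball.
  - by rewrite -[X in measurable X]setTI; apply: maff => //; exact: measurable_cube.
  - exact: measurable_funTS (measurableT_comp mg maff).
  - by move=> t _; rewrite lee_fin.
  - move=> t /eball_sub_cube tr i; have := tr i; rewrite !mxE subr0.
    by rewrite [(_ + _ - _)%R]addrC addKr normrM gtr0_norm// ltr_pM2l.
rewrite lte_pdivlMl ?exprn_gt0//; apply: le_lt_trans.
rewrite lee_fin -mulrnAr exprMn.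
have -> : (l / n.+1%:R ^+ n * (posR_val y ^+ n * (r *+ 2) ^+ n) =
    posR_val y ^+ n * ((r *+ 2 / n.+1%:R) ^+ n * l))%R.
  by rewrite expr_div_n; ring.
by rewrite ler_pM2l ?exprn_gt0// ler_pM2r.
Qed.

Lemma maximal_trans_weak_type f (l : R) : measurable_fun setT f -> (0 < l)%R ->
  haar_Gn R n [set z | l%:E < maximal_trans f z] <=
    (weak_const / l)%:E * \int[haar_Gn R n]_z `|f z|%:E.
Proof.
move=> mf l0; have mA := measurable_maximal_level l%:E mf.
have mf' : measurable_fun setT (fun z => `|f z|%:E).
  by apply/measurable_EFinP; exact: measurableT_comp.
rewrite haar_Gn_ysection// fubini_tonelli2//.
rewrite -ge0_integralZl//; last 3 first.
- exact: measurable_fun_fubini_tonelli_G.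
- by move=> y _; exact: integral_ge0.
- by rewrite lee_fin divr_ge0 ?ltW// weak_const_gt0.
apply: ge0_le_integral => //.
- exact: measurable_fun_ysection.
- apply: emeasurable_funM => //; exact: measurable_fun_fubini_tonelli_G.
move=> y _; rewrite /fubini_G.
pose k := (l / (2 * n.+1%:R) ^+ n)%R.
have k0 : (0 < k)%R by rewrite divr_gt0// exprn_gt0// mulr_gt0.
have -> : (weak_const / l = 3 ^+ n / k)%R.
  by rewrite /k invf_div mulrA /weak_const exprMn.
apply: weak_type_cubes => //.
- exact: measurable_slice.
- exact: measurable_ysection.
- move=> x; rewrite /ysection/= inE/= maximal_transE => /ereal_sup_gt.
  move=> [_ [r /= r0 <-]] lr; exists (posR_val y * r)%R.
    by rewrite mulr_gt0// /posR_val.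
  apply: le_lt_trans (ball_mean_cube mf l0 r0 lr).
  rewrite lee_fin ler_wpM2r//; last first.
    by rewrite /k exprMn invfM mulrCA mulVKf.
  by rewrite exprn_ge0// mulrn_wge0// mulr_ge0 ?(ltW r0)// /posR_val.
Qed.

(** [|f| <= |f1| + a] pointwise, where [f1] is [f] cut off to [{|f| > a}], and
    the mean of a constant is that constant. *)
Lemma maximal_trans_truncate f (a : R) z : measurable_fun setT f -> (0 <= a)%R ->
  maximal_trans f z <=
    maximal_trans (fun w => f w * \1_[set u | a < `|f u|]%R w)%R z + a%:E.
Proof.
move=> mf a0; set f1 := fun w => _.
have mn : measurable_fun setT (fun u => `|f u|%R) by exact: measurableT_comp.
have mS : measurable [set u | a < `|f u|]%R := measurable_super_level a mn.
have mf1 : measurable_fun setT f1.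
  by apply: measurable_funM => //; exact: measurable_indic.
rewrite [X in X <= _]maximal_transE; apply: ge_ereal_sup => _ /= [r r0 <-].
apply: (@le_trans _ _ (ball_mean f1 z r + a%:E)); last first.
  by rewrite leeD2r// maximal_transE; apply: ereal_sup_ubound; exists r.
have [v [v0 vE _ _]] := @eball_volume R n r r0.
rewrite /ball_mean vE inver gt_eqF// lee_pdivrMl// muleDr//; last first.
  by rewrite ge0_adde_def// inE ?lee_fin// mule_ge0 ?lee_fin ?invr_ge0 ?(ltW v0)//
    integral_ge0// => t _; rewrite lee_fin.
rewrite muleA -EFinM divff ?gt_eqF// mul1e -vE muleC -integral_cst; last first.
  exact: measurable_eball.
have mE := @measurable_eball R n r.
rewrite -ge0_integralD//; last exact: measurable_funTS (measurable_translated mf1 _).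
apply: ge0_le_integral => //.
- exact: measurable_funTS (measurable_translated mf _).
- by apply: emeasurable_funD => //; exact: measurable_funTS (measurable_translated mf1 _).
move=> t _; rewrite -EFinD lee_fin /f1 indicE.
have [w] : exists w, w = (affine z.1 (posR_val z.2) t, z.2) by eexists.
move=> <-; have [aw|wa] := ltP a `|f w|%R.
  by rewrite mem_set//= mulr1 lerDl.
by rewrite memNset ?mulr0 ?normr0 ?add0r//=; apply/negP; rewrite -leNgt.
Qed.

Lemma maximal_trans_weak_type_truncated f (a l : R) : measurable_fun setT f ->
  (0 <= a)%R -> (0 < l)%R ->
  haar_Gn R n [set z | (a + l)%:E < maximal_trans f z] <= (weak_const / l)%:E *
    \int[haar_Gn R n]_(z in [set u | a < `|f u|]%R) `|f z|%:E.
Proof.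
move=> mf a0 l0; pose S := [set u | a < `|f u|]%R.
have mn : measurable_fun setT (fun u => `|f u|%R) by exact: measurableT_comp.
have mS : measurable S := measurable_super_level a mn.
pose f1 := (fun w => f w * \1_S w)%R.
have mf1 : measurable_fun setT f1.
  by apply: measurable_funM => //; exact: measurable_indic.
rewrite [in leRHS]integral_mkcond epatch_indic.
rewrite (eq_integral (fun z => `|f1 z|%:E)); last first.
  by move=> z _; rewrite /f1 normrM EFinM/= [X in _ = _ * X%:E]ger0_norm.
apply: le_trans (maximal_trans_weak_type mf1 l0).
apply: le_measure; rewrite ?inE; [exact: measurable_maximal_level|
  exact: measurable_maximal_level|].
move=> z /= /lt_le_trans /(_ (maximal_trans_truncate z mf a0)).
by rewrite EFinD addeC lteD2rE.
Qed.

End weak_type.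

(** * The case p = oo *)

(** With [a] the essential supremum of [|f|] the truncated weak type bound says
    that [{M f > a + e}] is negligible for all [e > 0]. *)
Lemma maximal_trans_Linfty (R : realType) n (f : Gn R n -> R) :
  measurable_fun setT f ->
  'N[haar_Gn R n]_+oo[maximal_trans f] <= 'N[haar_Gn R n]_+oo[EFin \o f].
Proof.
move=> mf; have mf' : measurable_fun setT (EFin \o f) by exact/measurable_EFinP.
have := Lnorm_ge0 (haar_Gn R n) +oo (EFin \o f); rewrite unlock.
case: ifPn => // _ S0.
have aeS := @ess_sup_ge _ _ _ (haar_Gn R n) (abse \o EFin \o f).
move: S0 aeS; set S := ess_sup _ _; case: S => [a| |//]; last by move=> *; rewrite leey.
rewrite lee_fin => a0 aef.
have mn : measurable_fun setT (fun u => `|f u|%R) by exact: measurableT_comp.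
have mS : measurable [set u | a < `|f u|]%R := measurable_super_level a mn.
have S0 : haar_Gn R n [set u | a < `|f u|]%R = 0.
  have [N [mN N0 subN]] := aef.
  apply/eqP; rewrite eq_le measure_ge0 andbT -N0; apply: le_measure; rewrite ?inE//.
  apply: subset_trans subN => u /= au /=; rewrite lee_fin; apply/negP.
  by rewrite -ltNge.
apply/lee_addgt0Pr => e e0; apply/ess_supP.
exists [set z | (a + e)%:E < maximal_trans f z]; split.
- exact: measurable_maximal_level.
- apply/eqP; rewrite eq_le measure_ge0 andbT.
  apply: le_trans (maximal_trans_weak_type_truncated mf a0 e0) _.
  rewrite (_ : integral _ _ _ = 0) ?mule0//.
  exact: (integral_abs_eq0 mS (measurable_funTS mf') S0).
- move=> z /= /negP; rewrite -ltNge gee0_abs//; exact: maximal_trans_ge0.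
Qed.

(** * Marcinkiewicz interpolation *)

(** A geometric progression is dominated by its last term, here the last one
    below [B], up to the factor [q / (q - 1)]. *)
Lemma geometric_sum_below (R : realType) (a q B : R) (M : nat) :
  (0 < a)%R -> (1 < q)%R -> (0 <= B)%R ->
  (\sum_(k < M) (if a * q ^+ k < B then a * q ^+ k else 0) <= B * (q / (q - 1)))%R.
Proof.
move=> a0 q1 B0; have q0 : (0 < q)%R by rewrite (lt_trans _ q1).
have q10 : (0 < q - 1)%R by rewrite subr_gt0.
have aq k : (0 < a * q ^+ k)%R by rewrite mulr_gt0// exprn_gt0.
pose S m : R := (\sum_(k < m) (if a * q ^+ k < B then a * q ^+ k else 0))%R.
(* the sum of all terms is at most the next term over [q - 1] *)
have S1 m : (S m * (q - 1) <= a * q ^+ m)%R.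
  elim: m => [|m IH]; first by rewrite /S big_ord0 mul0r ltW.
  rewrite /S big_ord_recr/= -/(S m) mulrDl exprS.
  apply: (@le_trans _ _ (a * q ^+ m + a * q ^+ m * (q - 1))%R); last first.
    by rewrite [leRHS](_ : _ = a * q ^+ m + a * q ^+ m * (q - 1))%R//; ring.
  rewrite lerD// ler_pM2r//; case: ifP => // _; exact: ltW.
rewrite mulrA ler_pdivlMr// -/(S M); elim: M => [|M IH].
  by rewrite /S big_ord0 mul0r mulr_ge0// ltW.
have [aB|Ba] := ltP (a * q ^+ M)%R B.
  apply: le_trans (S1 _) _; rewrite exprSr mulrA ler_pM2r//; exact: ltW.
by rewrite /S big_ord_recr/= ltNge Ba/= addr0.
Qed.

Section marcinkiewicz.
Context d (T : measurableType d) (R : realType).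
Variables (m : {measure set T -> \bar R}) (F : T -> \bar R) (h : T -> R) (K p : R).
Hypotheses (mF : measurable_fun setT F) (F0 : forall x, 0 <= F x).
Hypotheses (mh : measurable_fun setT h) (h0 : forall x, (0 <= h x)%R).
Hypotheses (K0 : (0 < K)%R) (p1 : (1 < p)%R).
Hypothesis weak : forall l : R, (0 < l)%R ->
  m [set x | (l + l)%:E < F x] <= (K / l)%:E * \int[m]_(x in [set u | l < h u]%R) (h x)%:E.

Let p0 : (0 < p)%R. Proof. exact: lt_trans p1. Qed.

Definition above (l : R) : set T := [set x | l%:E < F x].

(** For each [N], the levels [level N k] with [k <= 2 N] run through the powers
    of 2 from [2 ^ - N] to [2 ^ N]. *)
Definition level (N k : nat) : R := (2 ^+ k / 2 ^+ N)%R.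

Lemma level_gt0 N k : (0 < level N k)%R.
Proof. by rewrite divr_gt0// exprn_gt0. Qed.

Lemma levelS N k : level N k.+1 = (level N k + level N k)%R.
Proof. by rewrite /level exprS -mulrA mulr_natl mulr2n. Qed.

(** [F ^ p], set to zero where [F] is at most twice the lowest level and capped
    at twice the highest one, so that finitely many levels control it.  The
    factor 2 is that of the hypothesis [weak], which bounds the measure of
    [{F > 2 l}]. *)
Definition cutoff (N : nat) (x : T) : \bar R :=
  if (level N 1)%:E < F x then (mine (F x) (level 0 N.+1)%:E) `^ p else 0.

Definition marcinkiewicz_const : R :=
  (4 `^ p * K * (2 `^ (p - 1) / (2 `^ (p - 1) - 1)))%R.

Lemma cutoff_ge0 N x : 0 <= cutoff N x.
Proof. by rewrite /cutoff; case: ifP => // _; exact: poweR_ge0. Qed.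

(** Where the cut-off function does not vanish, take the largest [k] with
    [2 * level N k < F x].  Then either [F x <= 4 * level N k], or [k] is the
    last index and the cap applies: one term of the sum suffices. *)
Lemma cutoff_le_sum N x : cutoff N x <=
  \sum_(k < N.*2.+1) ((4 * level N k) `^ p * \1_(above (level N k.+1)) x)%:E.
Proof.
have t0 (k : 'I_N.*2.+1) :
    0 <= ((4 * level N k) `^ p * \1_(above (level N k.+1)) x)%:E.
  by rewrite lee_fin mulr_ge0// powR_ge0.
rewrite /cutoff; case: ifPn => [lF|_]; last exact: sume_ge0.
have [k [kN lk Fk]] : exists k : nat, [/\ (k < N.*2.+1)%N, (level N k.+1)%:E < F x &
    mine (F x) (level 0 N.+1)%:E <= (4 * level N k)%:E].
  have E M : (M < N.*2.+1)%N -> (level N M.+1)%:E < F x \/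
      exists k : nat, [/\ (k < N.*2.+1)%N, (level N k.+1)%:E < F x &
    mine (F x) (level 0 N.+1)%:E <= (4 * level N k)%:E].
    elim: M => [|M IH] MN; first by left.
    have [lM|//] := IH (ltnW MN); last by right.
    have [lM1|FM1] := ltP (level N M.+2)%:E (F x); first by left.
    right; exists M; split => //; first exact: ltnW.
    rewrite ge_min; apply/orP; left; apply: le_trans FM1 _.
    by rewrite lee_fin !levelS; lra.
  have [lN|//] := E N.*2 (ltnSn _).
  exists N.*2; split => //; rewrite ge_min; apply/orP; right.
  rewrite lee_fin /level expr0 divr1 -addnn exprD mulfK ?expf_neq0//.
  by rewrite exprS ler_wpM2r ?exprn_ge0// ler_nat.
apply: (@le_trans _ _ ((4 * level N k) `^ p)%:E).
  rewrite -poweR_EFin; apply: gt0_ler_poweR => //; first exact: ltW.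
    by rewrite in_itv/= leey le_min F0/= lee_fin ltW// level_gt0.
  by rewrite in_itv/= leey lee_fin mulr_ge0// ltW// level_gt0.
rewrite (bigD1 (Ordinal kN))//= indicE mem_set//= mulr1 leeDl//.
by apply: sume_ge0 => i _; exact: t0.
Qed.

Lemma level_powR N k :
  (level N k `^ (p - 1) = ((2 ^+ N)^-1 `^ (p - 1)) * (2 `^ (p - 1)) ^+ k)%R.
Proof.
rewrite /level mulrC powRM ?invr_ge0 ?exprn_ge0//; congr (_ * _)%R.
by rewrite -powR_mulrn// powRAC powR_mulrn ?powR_ge0.
Qed.

(** The terms with [level N k < h x] are, up to a constant, [h x] times the
    geometric progression [level N k ^ (p - 1)] stopped at [h x ^ (p - 1)].
    This sum converges at small levels because [p > 1]. *)
Lemma sum_level_le N M x :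
  (\sum_(k < M) ((4 * level N k) `^ p * (K / level N k) *
     (h x * \1_[set u | level N k < h u] x)) <= marcinkiewicz_const * h x `^ p)%R.
Proof.
rewrite -(@mulr_powRB1 _ (h x) p)//.
have q1 : (1 < 2 `^ (p - 1) :> R)%R.
  have := @gt0_ltr_powR R (p - 1)%R; rewrite subr_gt0 => /(_ p1 1%R 2%R).
  by rewrite !nnegrE ler01 ler0n ltr1n powR1; apply.
have := @geometric_sum_below R ((2 ^+ N)^-1 `^ (p - 1)) (2 `^ (p - 1))
  (h x `^ (p - 1)) M.
rewrite powR_gt0 ?invr_gt0 ?exprn_gt0// q1 powR_ge0 => /(_ isT isT isT) gs.
have -> : (marcinkiewicz_const * (h x * h x `^ (p - 1)) = 4 `^ p * K * h x *
   (h x `^ (p - 1) * (2 `^ (p - 1) / (2 `^ (p - 1) - 1))))%R.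
  by rewrite /marcinkiewicz_const; ring.
apply: le_trans (ler_wpM2l _ gs); last first.
  by rewrite !mulr_ge0 ?powR_ge0// ltW.
rewrite mulr_sumr; apply: ler_sum => k _; rewrite indicE -level_powR.
have l0 := level_gt0 N k.
have [lh|hl] := ltP (level N k) (h x); last first.
  rewrite memNset ?mulr0; last by apply/negP; rewrite -leNgt.
  apply: mulr_ge0; first by rewrite !mulr_ge0 ?powR_ge0// ltW.
  by case: ifP => // _; exact: powR_ge0.
rewrite mem_set//= mulr1 gt0_ltr_powR ?subr_gt0// ?inE ?nnegrE ?(ltW l0)//.
rewrite powRM ?(ltW l0)// -(mulr_powRB1 (ltW l0))//.
rewrite le_eqVlt; apply/orP; left; apply/eqP; field.
by rewrite gt_eqF.
Qed.

Lemma measurable_above (l : R) : measurable (above l).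
Proof. by rewrite -[X in measurable X]setTI; apply: emeasurable_fun_o_infty. Qed.

Lemma measurable_cutoff N : measurable_fun setT (cutoff N).
Proof.
apply: measurable_fun_ifT => //.
  apply: (measurable_fun_bool true).
  rewrite setTI (_ : _ @^-1` _ = above (level N 1))//.
  exact: measurable_above.
apply: (@measurableT_comp _ _ _ _ _ _ (fun x : \bar R => x `^ p)) => //.
  exact: measurable_poweR.
by apply: measurable_mine.
Qed.

(** The weak type hypothesis at each level, followed by the exchange of the sum
    over the levels with the integral.  The bound is uniform in [N]. *)
Lemma integral_cutoff_le N :
  \int[m]_x cutoff N x <= marcinkiewicz_const%:E * \int[m]_x (h x `^ p)%:E.
Proof.
have mhp : measurable_fun setT (fun x => (h x `^ p)%:E).
  by apply/measurable_EFinP; exact: (measurableT_comp (measurable_powR _)).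
have C0 : (0 <= marcinkiewicz_const)%R.
  rewrite !mulr_ge0 ?powR_ge0 ?(ltW K0)// invr_ge0 subr_ge0.
  by rewrite -[leLHS](powRr0 2) ler_powR ?subr_ge0 ?ler1n// ltW.
apply: (@le_trans _ _ (\int[m]_x \sum_(k < N.*2.+1)
    ((4 * level N k) `^ p * \1_(above (level N k.+1)) x)%:E)).
  apply: ge0_le_integral => //.
  - by move=> x _; exact: cutoff_ge0.
  - exact: measurable_cutoff.
  - apply: emeasurable_sum => k; apply/measurable_EFinP.
    apply: measurable_funM => //; apply: measurable_indic.
    exact: measurable_above.
  - by move=> x _; exact: cutoff_le_sum.
rewrite ge0_integral_sum//; last 2 first.
- move=> k; apply/measurable_EFinP; apply: measurable_funM => //.
  by apply: measurable_indic; exact: measurable_above.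
- by move=> k x _; rewrite lee_fin mulr_ge0// powR_ge0.
have mterm (k : nat) : measurable_fun setT
    (fun x => (h x * \1_[set u | level N k < h u]%R x)%:E).
  apply/measurable_EFinP; apply: measurable_funM => //.
  by apply: measurable_indic; exact: measurable_super_level.
have c0 (k : nat) : (0 <= (4 * level N k) `^ p * (K / level N k))%R.
  by rewrite mulr_ge0 ?powR_ge0// divr_ge0 ?(ltW K0)// ltW// level_gt0.
apply: (@le_trans _ _ (\sum_(k < N.*2.+1) \int[m]_x
   (((4 * level N k) `^ p * (K / level N k))%:E *
     (h x * \1_[set u | level N k < h u]%R x)%:E))).
  apply: lee_sum => k _.
  under eq_integral do rewrite EFinM.
  rewrite ge0_integralZl_EFin ?powR_ge0//; last first.
    apply/measurable_EFinP; apply: measurable_indic; exact: measurable_above.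
  rewrite integral_indic ?setIT//; last exact: measurable_above.
  rewrite ge0_integralZl_EFin//; last by move=> x _; rewrite lee_fin mulr_ge0.
  rewrite EFinM -muleA lee_wpmul2l ?lee_fin ?powR_ge0// levelS.
  apply: le_trans (weak (level_gt0 N k)) _.
  rewrite integral_mkcond epatch_indic.
  by under eq_integral do rewrite /= -EFinM.
rewrite -ge0_integral_sum//; last 2 first.
- by move=> k; apply: emeasurable_funM => //; exact: mterm.
- by move=> k x _; rewrite mule_ge0 ?lee_fin// mulr_ge0.
rewrite -ge0_integralZl_EFin//; last by move=> x _; rewrite lee_fin powR_ge0.
apply: ge0_le_integral => //.
- by move=> x _; apply: sume_ge0 => k _; rewrite mule_ge0 ?lee_fin// mulr_ge0.
- apply: emeasurable_sum => k; apply: emeasurable_funM => //; exact: mterm.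
- exact: emeasurable_funM.
move=> x _; under eq_bigr do rewrite -EFinM.
by rewrite sumEFin -EFinM lee_fin; exact: sum_level_le.
Qed.

End marcinkiewicz.

Lemma ler_nat_exp2 (R : realType) (N : nat) : (N%:R <= 2 ^+ N :> R)%R.
Proof. by rewrite -natrX ler_nat ltnW// ltn_expl. Qed.

Lemma nondecreasing_cutoff d (T : measurableType d) (R : realType)
    (F : T -> \bar R) (p : R) x :
  (0 < p)%R -> (forall x, 0 <= F x) -> nondecreasing_seq (cutoff F p ^~ x).
Proof.
move=> p0 F0; apply/nondecreasing_seqP => N; rewrite /cutoff.
have lN : (level R N.+1 1 <= level R N 1)%R.
  by rewrite /level ler_pM2l ?exprn_gt0// lef_pV2 ?posrE ?exprn_gt0// exprS
    ler_peMl ?exprn_ge0// ler1n.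
case: ifPn => [lF|_]; last by case: ifP => // _; exact: poweR_ge0.
rewrite (le_lt_trans _ lF) ?lee_fin//.
have lv0 M : (0 <= level R 0 M)%R by rewrite divr_ge0// exprn_ge0.
apply: gt0_ler_poweR; first exact: ltW.
- by rewrite in_itv/= leey le_min F0 lee_fin lv0.
- by rewrite in_itv/= leey le_min F0 lee_fin lv0.
rewrite le_min !ge_min lexx/= lee_fin /level expr0 !divr1; apply/orP; right.
by rewrite [leRHS]exprS ler_peMl ?exprn_ge0// ler1n.
Qed.

Lemma cvg_cutoff d (T : measurableType d) (R : realType)
    (F : T -> \bar R) (p : R) x : (1 < p)%R ->
  (forall x, 0 <= F x) -> cutoff F p N x @[N --> \oo] --> F x `^ p.
Proof.
move=> p1 F0; have p0 : (0 < p)%R by exact: lt_trans p1.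
have := F0 x; rewrite le_eqVlt => /predU1P[Fx0|].
  rewrite -Fx0 poweR0r ?gt_eqF// (_ : (fun _ => _) = cst 0); first exact: cvg_cst.
  apply/funext => N; rewrite /cutoff -Fx0 ltNge ifF//; apply/negbF.
  by rewrite lee_fin divr_ge0// exprn_ge0.
have lv0 M : (0 < level R 0 M)%R by rewrite divr_gt0// exprn_gt0.
case Fx : (F x) => [u| |//] Fx0; last first.
  rewrite poweRyr ?gt_eqF//; apply/cvgeyPge => A; near=> N.
  rewrite /cutoff Fx ltry minye poweR_EFin lee_fin.
  have AN : (A <= N%:R)%R by near: N; exact: nbhs_infty_ger.
  apply: (le_trans AN); apply: (le_trans (ler_nat_exp2 R N)).
  have l2 : (2 ^+ N <= level R 0 N.+1)%R.
    by rewrite /level expr0 divr1 exprS ler_peMl ?exprn_ge0// ler1n.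
  apply: (le_trans l2); apply: le1r_powR; last exact: ltW.
  by apply: le_trans l2; rewrite exprn_ege1// ler1n.
rewrite lte_fin in Fx0; apply: cvg_near_cst; near=> N.
have uN : (u <= N%:R)%R by near: N; exact: nbhs_infty_ger.
have VN : (2 / u < N%:R)%R by near: N; exact: nbhs_infty_gtr.
have N2 := ler_nat_exp2 R N.
rewrite /cutoff Fx lte_fin ifT.
  congr (_ `^ p); apply/min_idPl; rewrite lee_fin /level expr0 divr1.
  apply: le_trans uN _; apply: le_trans N2 _.
  by rewrite exprS ler_peMl ?exprn_ge0// ler1n.
rewrite /level expr1 ltr_pdivrMr ?exprn_gt0// mulrC -ltr_pdivrMr//.
exact: lt_le_trans N2.
Unshelve. all: by end_near. Qed.

(** Monotone convergence in the number of levels. *)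
Lemma marcinkiewicz d (T : measurableType d) (R : realType)
    (m : {measure set T -> \bar R}) (F : T -> \bar R) (h : T -> R) (K p : R) :
  measurable_fun setT F -> (forall x, 0 <= F x) ->
  measurable_fun setT h -> (forall x, (0 <= h x)%R) ->
  (0 < K)%R -> (1 < p)%R ->
  (forall l : R, (0 < l)%R -> m [set x | (l + l)%:E < F x] <=
    (K / l)%:E * \int[m]_(x in [set u | l < h u]%R) (h x)%:E) ->
  \int[m]_x F x `^ p <= (marcinkiewicz_const K p)%:E * \int[m]_x (h x `^ p)%:E.
Proof.
move=> mF F0 mh h0 K0 p1 weak; have p0 : (0 < p)%R by exact: lt_trans p1.
have nd := nondecreasing_cutoff _ p0 F0.
have cv x := @cvg_cutoff _ T R F p x p1 F0.
rewrite (eq_integral (fun x => limn (cutoff F p ^~ x))); last first.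
  by move=> x _; apply/esym/cvg_lim => //; exact: cv.
rewrite monotone_convergence//.
- apply: lime_le; last by apply: nearW => N; exact: integral_cutoff_le.
  apply: ereal_nondecreasing_is_cvgn => M N MN; apply: ge0_le_integral => //.
  + by move=> x _; exact: cutoff_ge0.
  + exact: measurable_cutoff.
  + exact: measurable_cutoff.
  + by move=> x _; exact: nd.
- by move=> N; exact: measurable_cutoff.
- by move=> N x _; exact: cutoff_ge0.
Qed.

(** The weak type bound truncated at [a = l] is the hypothesis of
    [marcinkiewicz] for [F = M f] and [h = |f|]. *)
Lemma maximal_trans_Lp (R : realType) n (p : R) (f : Gn R n -> R) : (1 < p)%R ->
  measurable_fun setT f ->
  'N[haar_Gn R n]_p%:E[maximal_trans f] <=
  (marcinkiewicz_const (weak_const R n) p `^ p^-1)%:E *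
    'N[haar_Gn R n]_p%:E[EFin \o f].
Proof.
move=> p1 mf; have p0 : (0 < p)%R by exact: lt_trans p1.
rewrite unlock.
have M0 := @maximal_trans_ge0 R n f.
under eq_integral do rewrite gee0_abs//.
rewrite -[\int[_]_x `|(EFin \o f) x| `^ p]/(\int[haar_Gn R n]_x (`|f x|%R `^ p)%:E).
have C0 : (0 <= marcinkiewicz_const (weak_const R n) p)%R.
  rewrite !mulr_ge0 ?powR_ge0 ?(ltW (weak_const_gt0 _ _))// invr_ge0 subr_ge0.
  by rewrite -[leLHS](powRr0 2) ler_powR ?subr_ge0 ?ler1n// ltW.
rewrite -poweR_EFin -poweRM; last 2 first.
- by rewrite lee_fin.
- by apply: integral_ge0 => x _; rewrite lee_fin powR_ge0.
apply: gt0_ler_poweR.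
- by rewrite invr_ge0 ltW.
- by rewrite in_itv/= leey andbT integral_ge0// => x _; exact: poweR_ge0.
- rewrite in_itv/= leey andbT mule_ge0 ?lee_fin// integral_ge0//.
apply: (@marcinkiewicz _ _ _ _ _ (fun x => `|f x|%R)) => //.
- exact: measurable_maximal_trans.
- exact: measurableT_comp.
- exact: weak_const_gt0.
- by move=> l l0; apply: maximal_trans_weak_type_truncated => //; exact: ltW.
Qed.

(** * Unboundedness on L^1 *)

Section unbounded_L1.
Variables (R : realType) (n : nat).
Local Notation mu := (lebesgue_rV R n).
Local Notation nu := (@dilation_measure R n).

Definition dilations12 : set (posR R) := (@posR_val R) @^-1` `[1%R, 2%R].

Definition box (a b : R) : set 'rV[R]_n :=
  [set v | forall i, `[a, b[%classic (v ord0 i)].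

Lemma measurable_dilations12 : measurable dilations12.
Proof.
rewrite -[X in measurable X]setTI; by apply: measurable_posR_val.
Qed.

Lemma measurable_box a b : measurable (box a b).
Proof.
by apply: (@measurable_rV_bigcap R n (fun=> `[a, b[%classic)) => i;
  exact: measurable_itv.
Qed.

Lemma lebesgue_rV_box_itv a b : (a < b)%R -> mu (box a b) = ((b - a) ^+ n)%:E.
Proof.
move=> ab; apply: (@lebesgue_rV_box R n (fun=> `[a, b[%classic)) => i.
  exact: measurable_itv.
by rewrite lebesgue_measure_itv/= lte_fin ab.
Qed.

(** On [[1, 2]] the density [y ^ - n.+1] lies between [2 ^ - n.+1] and 1. *)
Lemma dilation_measure12 : exists2 v : R, (0 < v)%R & nu dilations12 = v%:E.
Proof.
have D0 (y : R) : `[1%R, 2%R]%classic y -> (0 < y)%R.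
  by rewrite /= in_itv/= => /andP[y1 _]; exact: lt_le_trans y1.
have E : nu dilations12 =
    \int[lebesgue_measure]_(y in `[1%R, 2%R]) (y `^ (- n.+1%:R))%:E.
  rewrite /dilation_measure posR_image setIidl; last first.
    by move=> y /D0; rewrite /= in_itv/= andbT.
  by apply: eq_integral => y /[1!inE] /D0 y0; rewrite powR_invn ?ltW.
have mD : measurable (`[1%R, 2%R]%classic : set R) by exact: measurable_itv.
have mg : measurable_fun (`[1%R, 2%R]%classic : set R) (fun y : R => (y `^ (- n.+1%:R))%:E).
  by apply/measurable_EFinP; apply: measurable_funTS; exact: measurable_powR.
have L : lebesgue_measure (`[1%R, 2%R]%classic : set R) = 1.
  by rewrite lebesgue_measure_itv/= lte_fin ltr1n -EFinB; congr EFin; lra.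
have low : (2 ^- n.+1)%:E <= nu dilations12.
  rewrite E -[leLHS]mule1 -L -integral_cst//; apply: ge0_le_integral => //.
  - by move=> y _; rewrite lee_fin invr_ge0 exprn_ge0.
  - move=> y Dy; have y0 := D0 _ Dy; rewrite lee_fin powR_invn ?(ltW y0)//.
    rewrite lef_pV2 ?posrE ?exprn_gt0// lerXn2r ?nnegrE ?(ltW y0)//.
    by move: Dy; rewrite /= in_itv/= => /andP[].
have up : nu dilations12 <= 1.
  rewrite E -[leRHS]mul1e -[X in _ <= _ * X]L -integral_cst//; apply: ge0_le_integral => //.
  - by move=> y /D0 y0; rewrite lee_fin powR_ge0.
  - move=> y Dy; have y0 := D0 _ Dy; rewrite lee_fin powR_invn ?(ltW y0)//.
    rewrite invf_le1 ?exprn_gt0// exprn_ege1//.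
    by move: Dy; rewrite /= in_itv/= => /andP[].
have fin : nu dilations12 \is a fin_num.
  by rewrite ge0_fin_numE// (le_lt_trans up)// ltry.
exists (fine (nu dilations12)); last by rewrite fineK.
by rewrite -lte_fin fineK// (lt_le_trans _ low)// lte_fin invr_gt0 exprn_gt0.
Qed.

Definition block_indic : Gn R n -> R := \1_(box 0 1 `*` dilations12).

Lemma measurable_block_indic : measurable_fun setT block_indic.
Proof.
apply: measurable_indic; apply: measurableX.
  exact: measurable_box.
exact: measurable_dilations12.
Qed.

Lemma Lnorm1_block_indic : 'N[haar_Gn R n]_1[EFin \o block_indic] = nu dilations12.
Proof.
have mA : measurable (box 0 1 `*` dilations12).
  by apply: measurableX; [exact: measurable_box|exact: measurable_dilations12].
rewrite Lnorm1 (eq_integral (fun z => (\1_(box 0 1 `*` dilations12) z)%:E)).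
  rewrite integral_indic// setIT [LHS]product_measure1E.
  - by rewrite [X in X * _]lebesgue_rV_box_itv ?ltr01// subr0 expr1n mul1e.
  - exact: measurable_box.
  - exact: measurable_dilations12.
by move=> z _; rewrite /= ger0_norm.
Qed.

(** Requiring all the coordinates to lie in [[2 ^ k, 2 ^ k.+1)] picks one corner
    of a dyadic annulus: it is a cube, of volume [2 ^ (k n)], still comparable
    to that of the annulus. *)
Definition dyadic_corner (k : nat) : set 'rV[R]_n := box (2 ^+ k)%R (2 ^+ k.+1)%R.

(** For [x] in the corner and [y >= 1], the ball of radius [n.+1 * 2 ^ k.+1]
    contains all [t] with [x + y t] in the unit cube, a set of volume
    [y ^ - n >= 2 ^ - n]. *)
Lemma maximal_trans_block_indic_ge k z : (dyadic_corner k `*` dilations12) z ->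
  (((8 * n.+1%:R) ^- n * (2 ^+ k) ^- n)%R)%:E <= maximal_trans block_indic z.
Proof.
case: z => x y [/= xk]; rewrite /dilations12/= in_itv/= => /andP[y1 y2].
have y0 : (0 < posR_val y)%R by rewrite /posR_val.
pose r : R := (n.+1%:R * 2 ^+ k.+1)%R.
have r0 : (0 < r)%R by rewrite mulr_gt0// exprn_gt0.
apply: (@le_trans _ _ (ball_mean block_indic (x, y) r)); last first.
  by rewrite maximal_transE; apply: ereal_sup_ubound; exists r.
have [v [v0 vE _ v2]] := @eball_volume R n r r0.
have mpre : measurable (affine x (posR_val y) @^-1` (box 0 1)).
  rewrite -[X in measurable X]setTI; apply: measurable_fun_affine => //.
  exact: measurable_box.
have low : (2 ^- n)%:E <= mu (affine x (posR_val y) @^-1` (box 0 1)).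
  rewrite lebesgue_rV_affine//; last exact: measurable_box.
  rewrite [X in _ * X]lebesgue_rV_box_itv ?ltr01// subr0 expr1n mule1 lee_fin.
  by rewrite lef_pV2 ?posrE ?exprn_gt0// lerXn2r ?nnegrE// ltW.
have sub : affine x (posR_val y) @^-1` (box 0 1) `<=` @eball R n r.
  move=> t tQ; apply: cube_sub_eball; first by rewrite exprn_gt0.
  move=> i; have := tQ i; have := xk i.
  rewrite /= !in_itv/= !mxE subr0 => /andP[x1 x2] /andP[t1 t2].
  have k1 : (1 <= 2 ^+ k :> R)%R by rewrite exprn_ege1// ler1n.
  apply: (@le_lt_trans _ _ (posR_val y * `|t ord0 i|)%R).
    by rewrite ler_peMl.
  rewrite -{1}(gtr0_norm y0) -normrM ltr_norml; apply/andP; split.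
    by rewrite ltrNl; lra.
  by rewrite exprS; lra.
rewrite /ball_mean vE inver gt_eqF// lee_pdivlMl//.
apply: (@le_trans _ _ (mu (affine x (posR_val y) @^-1` (box 0 1)))).
  apply: le_trans low; rewrite lee_fin.
  apply: (@le_trans _ _ ((r *+ 2) ^+ n * ((8 * n.+1%:R) ^- n * 2 ^+ k ^- n))%R).
    rewrite ler_pM2r// mulr_gt0// invr_gt0 exprn_gt0// ?mulr_gt0// exprn_gt0//.
  rewrite -!exprVn -!exprMn; apply: lerXn2r; rewrite ?nnegrE.
  - by rewrite !mulr_ge0 ?mulrn_wge0 ?(ltW r0)// invr_ge0 ?mulr_ge0// exprn_ge0.
  - by rewrite invr_ge0.
  have E (N P : R) : N != 0%R -> P != 0%R ->
      ((N * (2 * P)) *+ 2 * ((8 * N)^-1 * P^-1) = 2^-1)%R.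
    by move=> N0 P0; field; rewrite N0 P0.
  by rewrite /r exprS ?exprVn E// expf_neq0.
rewrite -[leLHS]mul1e -integral_cst//.
apply: (@le_trans _ _ (\int[mu]_(t in affine x (posR_val y) @^-1` (box 0 1))
   `|block_indic (affine x (posR_val y) t, y)|%:E)).
  under [leRHS]eq_integral.
    move=> t /[1!inE] tQ; rewrite /block_indic indicE mem_set/= ?normr1; last first.
      by split => //=; rewrite /dilations12/= in_itv/= y1.
    over.
  by [].
apply: ge0_subset_integral => //.
- exact: measurable_eball.
- exact: measurable_funTS (measurable_translated measurable_block_indic (x, y)).
Qed.

(** One coordinate separates two corners; for [n = 0] they would all coincide. *)
Lemma trivIset_dyadic_corner (D : set nat) : (0 < n)%N ->
  trivIset D (fun k => dyadic_corner k `*` dilations12).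
Proof.
move=> n0 j k _ _ [[x y] [[/= xj _] [/= xk _]]].
have := xj (Ordinal n0); have := xk (Ordinal n0).
rewrite /= !in_itv/= => /andP[k1 k2] /andP[j1 j2].
have e i i' : (2 ^+ i < 2 ^+ i'.+1 :> R)%R -> (i <= i')%N.
  by rewrite ltr_eXn2l ?ltr1n.
apply/eqP; rewrite eqn_leq.
by rewrite (e _ _ (le_lt_trans j1 k2)) (e _ _ (le_lt_trans k1 j2)).
Qed.

(** Each of the disjoint sets [dyadic_corner k `*` dilations12] contributes at
    least the same amount [c * v] to the integral. *)
Lemma maximal_trans_block_indic_not_integrable : (0 < n)%N ->
  \int[haar_Gn R n]_z maximal_trans block_indic z = +oo.
Proof.
move=> n0; have [v v0 vE] := dilation_measure12.
pose c : R := (8 * n.+1%:R) ^- n.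
have c0 : (0 < c)%R by rewrite invr_gt0 exprn_gt0// mulr_gt0.
have mA k : measurable (dyadic_corner k `*` dilations12).
  by apply: measurableX; [exact: measurable_box|exact: measurable_dilations12].
have mM := measurable_maximal_trans measurable_block_indic.
have M0 := @maximal_trans_ge0 R n block_indic.
have lowN (N : nat) : (N%:R * (c * v))%:E <= \int[haar_Gn R n]_z maximal_trans block_indic z.
  apply: (@le_trans _ _ (\int[haar_Gn R n]_(z in
      \big[setU/set0]_(k <- iota 0 N) (dyadic_corner k `*` dilations12))
      maximal_trans block_indic z)); last first.
    apply: ge0_subset_integral => //; exact: bigsetU_measurable.
  rewrite ge0_integral_bigsetU//; last 3 first.
  - exact: iota_uniq.
  - exact: trivIset_dyadic_corner.
  - exact: measurable_funTS.
  apply: (@le_trans _ _ (\sum_(k <- iota 0 N) (c * v)%:E)).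
    by rewrite sumEFin big_const_seq count_predT size_iota iter_addr_0 mulr_natl.
  apply: lee_sum => k _.
  apply: (@le_trans _ _ (\int[haar_Gn R n]_(z in dyadic_corner k `*` dilations12)
     (c * (2 ^+ k) ^- n)%R%:E)).
    rewrite integral_cst// [X in _ <= _ * X]product_measure1E; last 2 first.
    - exact: measurable_box.
    - exact: measurable_dilations12.
    have k0 : (0 < (2 ^+ k) ^+ n :> R)%R by rewrite !exprn_gt0.
    rewrite [X in _ <= _ * (X * _)]lebesgue_rV_box_itv; last first.
      by rewrite ltr_eXn2l ?ltr1n.
    rewrite [X in _ <= _ * (_ * X)]vE -!EFinM lee_fin.
    rewrite (_ : 2 ^+ k.+1 - 2 ^+ k = 2 ^+ k :> R)%R; last by rewrite exprS; ring.
    by rewrite -mulrA mulKf// gt_eqF.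
  apply: ge0_le_integral => //.
  - by move=> z _; rewrite lee_fin mulr_ge0 ?(ltW c0)// invr_ge0 !exprn_ge0.
  - exact: measurable_funTS.
  - by move=> z zk; exact: maximal_trans_block_indic_ge.
apply/eqyP => A A0; have cv0 : (0 < c * v)%R by rewrite mulr_gt0.
apply: le_trans (lowN (Num.truncn (A / (c * v))).+1).
by rewrite lee_fin -ler_pdivrMr// ltW// truncnS_gt.
Qed.

End unbounded_L1.

Lemma maximal_trans_unbounded_L1 (R : realType) (n : nat) : (0 < n)%N ->
  ~ (exists C : R, forall f : Gn R n -> R, f \in Lfun (haar_Gn R n) 1 ->
     'N[haar_Gn R n]_1[maximal_trans f] <=
       C%:E * 'N[haar_Gn R n]_1[EFin \o f]).
Proof.
move=> n0 [C hC]; have [v v0 vE] := dilation_measure12 R n.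
have fL : @block_indic R n \in Lfun (haar_Gn R n) 1.
  rewrite inE; apply/andP; split; rewrite inE/=.
    exact: measurable_block_indic.
  by rewrite /finite_norm Lnorm1_block_indic vE ltry.
have := hC _ fL; rewrite Lnorm1_block_indic vE Lnorm1.
under eq_integral do rewrite gee0_abs ?maximal_trans_ge0//.
by rewrite maximal_trans_block_indic_not_integrable.
Qed.

Theorem theorem1 (R : realType) (n : nat) (hn : (1 <= n)%N) :
  (exists C : R, forall f : Gn R n -> R, f \in Lfun (haar_Gn R n) 1 ->
     forall lambda : R, (0 < lambda)%R ->
     haar_Gn R n [set z | lambda%:E < maximal_trans f z] <=
       (C / lambda)%:E * 'N[haar_Gn R n]_1[EFin \o f]) /\
  (forall p : \bar R, 1 < p ->
     exists C : R, forall f : Gn R n -> R, f \in Lfun (haar_Gn R n) p ->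
     'N[haar_Gn R n]_p[maximal_trans f] <=
       C%:E * 'N[haar_Gn R n]_p[EFin \o f]) /\
  ~ (exists C : R, forall f : Gn R n -> R, f \in Lfun (haar_Gn R n) 1 ->
     'N[haar_Gn R n]_1[maximal_trans f] <=
       C%:E * 'N[haar_Gn R n]_1[EFin \o f]).
Proof.
have meas p (f : Gn R n -> R) : f \in Lfun (haar_Gn R n) p ->
    measurable_fun setT f by move=> /sub_Lfun_mfun; rewrite inE.
split; [|split].
- exists (weak_const R n) => f /meas mf lambda l0.
  by rewrite Lnorm1; exact: maximal_trans_weak_type.
- case=> [p| |//] p1.
    exists (marcinkiewicz_const (weak_const R n) p `^ p^-1)%R => f /meas mf.
    exact: maximal_trans_Lp.
  exists 1%R => f /meas mf; rewrite mul1e; exact: maximal_trans_Linfty.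
- exact: maximal_trans_unbounded_L1.
Qed.
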